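(* Let $\langle\mathcal{M},\mathbb{A},\in\rangle$ be a model of $ZFA$, let $\kappa$ be an infinite cardinal (in $\mathcal M$), and let $\mathcal{N}$ be a ${<}\kappa$-support permutation model of $\mathcal{M}$, i.e. $\mathcal{N}=PM(\mathcal{M},G,\mathcal{F}^G_{<\kappa})$ for some group $G\leqslant Sym(\mathbb{A})$ in $\mathcal{M}$. Then there is a $\kappa$-structure $\mathcal{A}\in\mathcal{M}$ with underlying set $\mathbb{A}$ such that $$\mathcal{N}=PM\big(\mathcal{M},Aut(\mathcal{A}),\mathcal{F}^{Aut(\mathcal{A})}_{<\kappa}\big).$$
   Context: $ZFA$ is set theory with atoms in the language $\{\in,\mathbb{A}\}$ ($\mathbb{A}$ a unary predicate): the axioms of $ZF$ with extensionality restricted to non-atoms (''sets''), plus: atoms have no elements, and the atoms form a set, also denoted $\mathbb{A}$. All notions below are taken inside $\mathcal{M}$. Every $\pi\in Sym(\mathbb{A})$ (bijections of $\mathbb{A}$) extends to the universe by $\pi(x)=\{\pi(y):y\in x\}$ for sets $x$. For $G\leqslant Sym(\mathbb{A})$, $G_x=\{\pi\in G:\pi(x)=x\}$. $TC(x)$ is the transitive closure of $x$. A normal filter $\mathcal F$ of subgroups of $G$ is a nonempty set of subgroups of $G$, closed under supergroups within $G$, finite intersections and conjugation by elements of $G$, with $G_a\in\mathcal F$ for all $a\in\mathbb{A}$. An element $x$ is symmetric w.r.t. $\mathcal{F}$ if $G_x\in\mathcal F$, and hereditarily symmetric if every $y\in TC(\{x\})$ is symmetric. $PM(\mathcal{M},G,\mathcal{F})$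 is the class of all hereditarily symmetric $x\in\mathcal M$; it is a model of $ZFA$. $\mathbb{A}^{<\kappa}$ is the set of sequences of atoms indexed by ordinals ${<}\kappa$. $\mathcal{F}^G_{<\kappa}$ is the normal filter of all subgroups $H\leqslant G$ such that $G_{\mathbf a}\leqslant H$ for some $\mathbf{a}\in\mathbb{A}^{<\kappa}$. A $\kappa$-structure is like a first-order structure except that predicates of any arity strictly less than $\kappa$ are allowed (a predicate of arity $n<\kappa$ on $\mathbb{A}$ is a subset of $\mathbb{A}^n$); $Aut(\mathcal{A})$ is the group of bijections of $\mathbb{A}$ preserving every predicate of $\mathcal{A}$. *)

(* Defs.v *)
Set Implicit Arguments.

(** * First-order structures for the language of membership and atoms *)

Record structure := Structure {
  carrier :> Type;
  mem : carrier -> carrier -> Prop;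
  atom : carrier -> Prop
}.
Arguments mem {_} _ _.
Arguments atom {_} _.

Notation "x ∈ y" := (mem x y) (at level 70, no associativity).

(** Formulas are in de Bruijn style: [FAll] and [FEx] bind variable 0.  They
    are needed only to state the Separation and Replacement schemas. *)
Inductive formula :=
| FMem (i j : nat)
| FEq (i j : nat)
| FAtom (i : nat)
| FNot (p : formula)
| FAnd (p q : formula)
| FOr (p q : formula)
| FImp (p q : formula)
| FAll (p : formula)
| FEx (p : formula).

Definition scons (T : Type) (x : T) (e : nat -> T) : nat -> T :=
  fun n => match n with O => x | S m => e m end.

Fixpoint sat (M : structure) (e : nat -> M) (p : formula) : Prop :=
  match p with
  | FMem i j => e i ∈ e j
  | FEq i j => e i = e j
  | FAtom i => atom (e i)
  | FNot p => ~ sat M e p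
  | FAnd p q => sat M e p /\ sat M e q
  | FOr p q => sat M e p \/ sat M e q
  | FImp p q => sat M e p -> sat M e q
  | FAll p => forall x : M, sat M (scons x e) p
  | FEx p => exists x : M, sat M (scons x e) p
  end.

(** * The axioms of ZFA *)

Definition is_set {M : structure} (x : M) : Prop := ~ atom x.

Definition subset {M : structure} (x y : M) : Prop :=
  forall z, z ∈ x -> z ∈ y.

Definition is_atoms {M : structure} (A : M) : Prop :=
  is_set A /\ forall x, x ∈ A <-> atom x.

Definition is_empty {M : structure} (x : M) : Prop :=
  is_set x /\ forall z, ~ z ∈ x.

(** [y = x ∪ {x}] *)
Definition is_succ {M : structure} (y x : M) : Prop :=
  is_set y /\ forall z, z ∈ y <-> z ∈ x \/ z = x.

(** [p = {x, y}] *)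
Definition is_upair {M : structure} (p x y : M) : Prop :=
  is_set p /\ forall z, z ∈ p <-> z = x \/ z = y.

(** Atoms are vacuously included in every set, hence the requirement
    [is_set z] in Power Set.  In Separation and Replacement the environment
    [e] supplies the parameters. *)
Record ZFA (M : structure) : Prop := {
  zfa_extensionality : forall x y : M, is_set x -> is_set y ->
    (forall z, z ∈ x <-> z ∈ y) -> x = y;
  zfa_atoms_empty : forall a z : M, atom a -> ~ z ∈ a;
  zfa_atoms_set : exists A : M, is_atoms A;
  zfa_pairing : forall x y : M, exists p, is_upair p x y;
  zfa_union : forall x : M, exists u, is_set u /\
    forall z, z ∈ u <-> exists y, y ∈ x /\ z ∈ y;
  zfa_powerset : forall x : M, exists p, is_set p /\
    forall z, z ∈ p <-> is_set z /\ subset z x;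
  zfa_infinity : exists w : M, is_set w /\
    (exists o, is_empty o /\ o ∈ w) /\
    (forall x, x ∈ w -> exists y, is_succ y x /\ y ∈ w);
  zfa_foundation : forall x : M, (exists y, y ∈ x) ->
    exists y, y ∈ x /\ forall z, z ∈ x -> ~ z ∈ y;
  zfa_separation : forall (p : formula) (e : nat -> M) (x : M),
    exists y, is_set y /\
      forall z, z ∈ y <-> z ∈ x /\ sat M (scons z e) p;
  zfa_replacement : forall (p : formula) (e : nat -> M) (x : M),
    (forall u v w, u ∈ x -> sat M (scons v (scons u e)) p ->
      sat M (scons w (scons u e)) p -> v = w) ->
    exists y, is_set y /\
      forall v, v ∈ y <-> exists u, u ∈ x /\ sat M (scons v (scons u e)) p
}.

(** * Functions, ordinals and cardinals inside a model

    Every notion below is the interpretation in [M] of a first-order formula: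
    all quantifiers range over elements of [M].  A set-theoretic operation is
    rendered by its graph, so that [is_op y x] reads [y = op x]. *)

(** Kuratowski pairs: [p = (x, y)] *)
Definition is_opair {M : structure} (p x y : M) : Prop :=
  exists s d, is_upair s x x /\ is_upair d x y /\ is_upair p s d.

(** [(x, y) ∈ f], i.e. [f(x) = y] when [f] is a function *)
Definition maps {M : structure} (f x y : M) : Prop :=
  exists p, is_opair p x y /\ p ∈ f.

Definition is_fun_on {M : structure} (f D : M) : Prop :=
  is_set f /\ is_set D /\
  (forall p, p ∈ f -> exists x y, x ∈ D /\ is_opair p x y) /\
  (forall x, x ∈ D -> exists! y, maps f x y).

Definition is_fun {M : structure} (f D C : M) : Prop :=
  is_fun_on f D /\ is_set C /\ forall x y, maps f x y -> y ∈ C.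

Definition is_bij {M : structure} (f D C : M) : Prop :=
  is_fun f D C /\ forall y, y ∈ C -> exists! x, maps f x y.

(** [h = f ∘ g] *)
Definition is_comp {M : structure} (h f g : M) : Prop :=
  forall x z, maps h x z <-> exists y, maps g x y /\ maps f y z.

Definition transitive {M : structure} (T : M) : Prop :=
  is_set T /\ forall x y, x ∈ T -> y ∈ x -> y ∈ T.

(** Transitive and linearly ordered by membership; well-foundedness is given by
    Foundation.  Atoms must be excluded explicitly, as the set containing a
    single atom is transitive. *)
Definition is_ordinal {M : structure} (x : M) : Prop :=
  transitive x /\ (forall y, y ∈ x -> is_set y) /\
  (forall y z, y ∈ x -> z ∈ x -> y ∈ z \/ y = z \/ z ∈ y).

Definition equinumerous {M : structure} (x y : M) : Prop :=
  exists f, is_bij f x y.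

Definition is_cardinal {M : structure} (k : M) : Prop :=
  is_ordinal k /\ forall a, a ∈ k -> ~ equinumerous a k.

Definition is_natural {M : structure} (n : M) : Prop :=
  is_ordinal n /\
  forall m, m ∈ n \/ m = n -> is_empty m \/ exists l, is_succ m l.

Definition is_finite {M : structure} (x : M) : Prop :=
  exists n, is_natural n /\ equinumerous n x.

Definition infinite_cardinal {M : structure} (k : M) : Prop :=
  is_cardinal k /\ ~ is_finite k.

(** * Permutations of the atoms and their action on the universe *)

Definition in_Sym {M : structure} (pi : M) : Prop :=
  exists A, is_atoms A /\ is_bij pi A A.

(** [G ⩽ Sym(𝔸)] *)
Definition perm_group {M : structure} (G : M) : Prop :=
  is_set G /\
  (forall pi, pi ∈ G -> in_Sym pi) /\
  (exists i, i ∈ G /\ forall a b, maps i a b <-> atom a /\ a = b) /\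
  (forall pi sg, pi ∈ G -> sg ∈ G -> exists rho, rho ∈ G /\ is_comp rho pi sg) /\
  (forall pi, pi ∈ G ->
     exists rho, rho ∈ G /\ forall a b, maps rho a b <-> maps pi b a).

Definition subgroup {M : structure} (H G : M) : Prop :=
  perm_group H /\ perm_group G /\ subset H G.

(** [π(x) = y] for the extension of [π] to the universe, witnessed by the
    restriction [f] of this extension to a transitive set [T] containing [x]. *)
Definition acts {M : structure} (pi x y : M) : Prop :=
  exists T f, transitive T /\ x ∈ T /\ is_fun_on f T /\
    (forall z w, maps f z w ->
       (atom z -> maps pi z w) /\
       (is_set z -> is_set w /\ forall v, v ∈ w <-> exists u, u ∈ z /\ maps f u v)) /\
    maps f x y.

(** [S = G_x] *)
Definition is_stab {M : structure} (S G x : M) : Prop :=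
  is_set S /\ forall pi, pi ∈ S <-> pi ∈ G /\ acts pi x x.

(** * Permutation models *)

(** [t = TC(x)] *)
Definition is_TC {M : structure} (t x : M) : Prop :=
  transitive t /\ subset x t /\
  forall t', transitive t' -> subset x t' -> subset t t'.

Definition symmetric {M : structure} (G F x : M) : Prop :=
  exists S, is_stab S G x /\ S ∈ F.

(** The class [PM(M, G, F)]. *)
Definition PM {M : structure} (G F : M) (x : M) : Prop :=
  forall s t, is_upair s x x -> is_TC t s ->
    forall y, y ∈ t -> symmetric G F y.

(** [a ∈ 𝔸^{<k}] *)
Definition atom_seq_lt {M : structure} (k a : M) : Prop :=
  exists A n, is_atoms A /\ n ∈ k /\ is_fun a n A.

(** [F] is the filter of the subgroups of [G] containing the stabilizer [G_a] of
    some [a ∈ 𝔸^{<k}]. *)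
Definition is_support_filter {M : structure} (F k G : M) : Prop :=
  is_set F /\
  forall H, H ∈ F <->
    subgroup H G /\
    exists a S, atom_seq_lt k a /\ is_stab S G a /\ subset S H.

Definition support_permutation_model {M : structure} (k : M) (N : M -> Prop) : Prop :=
  exists G F, perm_group G /\ is_support_filter F k G /\
    forall x, N x <-> PM G F x.

(** * Structures with predicates of arity less than [k]

    Such a structure is a pair [(A, P)] of its underlying set and a family [P]
    of predicates, indexed by an arbitrary set [I] of symbols and taking
    values [(n, R)], where [n < k] is the arity and [R ⊆ A^n]. *)
Definition is_kappa_structure {M : structure} (k A S : M) : Prop :=
  is_set A /\
  exists P I, is_opair S A P /\ is_fun_on P I /\
    forall i r, maps P i r ->
      exists n R, is_opair r n R /\ n ∈ k /\ is_set R /\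
        forall s, s ∈ R -> is_fun s n A.

(** An [n]-tuple [s] of elements of [A] is sent to [t = pi ∘ s]. *)
Definition is_automorphism {M : structure} (S pi : M) : Prop :=
  exists A P, is_opair S A P /\ is_bij pi A A /\
    forall i r n R, maps P i r -> is_opair r n R ->
      forall s t, is_fun s n A -> is_fun t n A -> is_comp t pi s ->
        (s ∈ R <-> t ∈ R).

(** [H = Aut(S)] *)
Definition is_Aut {M : structure} (H S : M) : Prop :=
  is_set H /\ forall pi, pi ∈ H <-> is_automorphism S pi.

(* Main.v *)
Require Import Defs.
From Stdlib Require Import Classical PeanoNat.

(** Let [H] be the automorphism group of the structure whose predicates are all
    [G]-invariant sets of sequences of length less than [kappa].  Since orbits are
    invariant, every [pi] in [H] agrees on each such sequence with some [g] in [G].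
    By induction on [x], a sequence [a] supporting [x] with respect to [G] supports
    [x] with respect to [H]: if [pi] in [H] fixes [a] and [u] in [x] has support
    [b], choose [g] in [G] agreeing with [pi] on [a] and [b]; by induction
    [g^-1 pi] fixes [u], hence [pi u = g u] is in [g x = x].  Covering [a] and [b]
    by one sequence of length less than [kappa] needs no choice, as
    [2 · q < kappa] for every [q < kappa]. *)

(** [M] is an arbitrary first-order structure, so Separation and Replacement, and with them
    induction and recursion inside [M], are available only for formulas with parameters. Hence each
    property to which they are applied comes with a proof of [D], mostly found by [dfn].

    The group [H] may be larger than [G], but arities and supports obey the same bound kappa, so [G]
    approximates [H] on every sequence that can serve as a support. The induction needs a support
    for each member of [x], not only for [x]; this is why the two notions of symmetry are compared
    on a whole transitive set. The passage back from [H] to [G] is immediate: as [G] is contained in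
    [H], the same sequence is still a support. *)

Definition up (r : nat -> nat) (n : nat) : nat :=
  match n with O => O | S m => S (r m) end.

Fixpoint rename (r : nat -> nat) (p : formula) : formula :=
  match p with
  | FMem i j => FMem (r i) (r j)
  | FEq i j => FEq (r i) (r j)
  | FAtom i => FAtom (r i)
  | FNot p => FNot (rename r p)
  | FAnd p q => FAnd (rename r p) (rename r q)
  | FOr p q => FOr (rename r p) (rename r q)
  | FImp p q => FImp (rename r p) (rename r q)
  | FAll p => FAll (rename (up r) p)
  | FEx p => FEx (rename (up r) p)
  end.

(** Lets formulas with clashing variables be combined. The assignments are related pointwise,
    because under a binder they agree only pointwise without functional extensionality. *)
Lemma sat_rename (M : structure) (p : formula) (r : nat -> nat) (e e' : nat -> M) :
  (forall n, e' n = e (r n)) -> (sat M e (rename r p) <-> sat M e' p).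
Proof.
  revert r e e'; induction p; simpl; intros r e e' He;
    rewrite ?He;
    try rewrite (IHp r e e' He);
    try rewrite (IHp1 r e e' He), (IHp2 r e e' He); try tauto.
  - assert (K : forall x, sat M (scons x e) (rename (up r) p) <-> sat M (scons x e') p).
    { intros x; apply IHp; intros [|n]; simpl; auto. }
    split; intros H x; apply K, H.
  - assert (K : forall x, sat M (scons x e) (rename (up r) p) <-> sat M (scons x e') p).
    { intros x; apply IHp; intros [|n]; simpl; auto. }
    split; intros [x H]; exists x; apply K, H.
Qed.

(** * Definability with parameters *)

Section Definability.
Context {M : structure}.

Definition val (e : nat -> M) (s : nat + M) : M :=
  match s with inl i => e i | inr c => c end.

(* Each free variable of the formula is assigned by [s] either a slot of the
   environment or a fixed element of [M]. *)
Definition D (P : (nat -> M) -> Prop) : Prop :=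
  exists (p : formula) (s : nat -> nat + M),
    forall e, sat M (fun n => val e (s n)) p <-> P e.

(** A case split on [Tm t] makes [t] a concrete slot or constant. Entering a binder then turns [e i]
    into [e (S i)] by reduction, which is again of this form; an abstract [t] would be stuck. *)
Inductive Tm : ((nat -> M) -> M) -> Prop :=
| Tm_var i : Tm (fun e => e i)
| Tm_const c : Tm (fun _ => c).

Lemma Tm_val (t : (nat -> M) -> M) : Tm t -> exists s, forall e, t e = val e s.
Proof.
  intros [i|c]; [exists (inl i)|exists (inr c)]; reflexivity.
Qed.

Lemma D_mem (t u : (nat -> M) -> M) : Tm t -> Tm u -> D (fun e => t e ∈ u e).
Proof.
  intros [a Ha]%Tm_val [b Hb]%Tm_val.
  exists (FMem 0 1), (fun n => match n with O => a | _ => b end); intros e; simpl.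
  rewrite Ha, Hb; tauto.
Qed.

Lemma D_eq (t u : (nat -> M) -> M) : Tm t -> Tm u -> D (fun e => t e = u e).
Proof.
  intros [a Ha]%Tm_val [b Hb]%Tm_val.
  exists (FEq 0 1), (fun n => match n with O => a | _ => b end); intros e; simpl.
  rewrite Ha, Hb; tauto.
Qed.

Lemma D_atom (t : (nat -> M) -> M) : Tm t -> D (fun e => atom (t e)).
Proof.
  intros [a Ha]%Tm_val.
  exists (FAtom 0), (fun n => a); intros e; simpl.
  rewrite Ha; tauto.
Qed.

Lemma D_not (P : (nat -> M) -> Prop) : D P -> D (fun e => ~ P e).
Proof.
  intros (p & s & H); exists (FNot p), s; intros e; simpl; rewrite H; tauto.
Qed.

(** The variables of one formula are moved to the even numbers and those of the other to the odd
    ones, so that a single assignment serves both. *)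
Lemma D_join (P Q : (nat -> M) -> Prop) : D P -> D Q ->
  exists p q s, forall e, (sat M (fun n => val e (s n)) p <-> P e) /\
                          (sat M (fun n => val e (s n)) q <-> Q e).
Proof.
  intros (p & s & Hp) (q & u & Hq).
  exists (rename (fun n => 2 * n) p), (rename (fun n => S (2 * n)) q),
    (fun n => if Nat.even n then s (Nat.div2 n) else u (Nat.div2 n)).
  intros e; split.
  - rewrite <- Hp; apply sat_rename; intros n.
    now rewrite Nat.even_mul, Nat.div2_double.
  - rewrite <- Hq; apply sat_rename; intros n.
    now rewrite Nat.even_succ, Nat.odd_mul, Nat.div2_succ_double.
Qed.

Lemma D_and (P Q : (nat -> M) -> Prop) : D P -> D Q -> D (fun e => P e /\ Q e).
Proof.
  intros HP HQ; destruct (D_join _ _ HP HQ) as (p & q & s & H).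
  exists (FAnd p q), s; intros e; simpl; destruct (H e); tauto.
Qed.

Lemma D_or (P Q : (nat -> M) -> Prop) : D P -> D Q -> D (fun e => P e \/ Q e).
Proof.
  intros HP HQ; destruct (D_join _ _ HP HQ) as (p & q & s & H).
  exists (FOr p q), s; intros e; simpl; destruct (H e); tauto.
Qed.

Lemma D_imp (P Q : (nat -> M) -> Prop) : D P -> D Q -> D (fun e => P e -> Q e).
Proof.
  intros HP HQ; destruct (D_join _ _ HP HQ) as (p & q & s & H).
  exists (FImp p q), s; intros e; simpl; destruct (H e); tauto.
Qed.

Lemma D_iff (P Q : (nat -> M) -> Prop) : D P -> D Q -> D (fun e => P e <-> Q e).
Proof.
  intros HP HQ; apply D_and; apply D_imp; assumption.
Qed.

(** Several variables may be assigned slot 0; all of them are merged into variable 0, which a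
    quantifier can bind. The other variables move up by one and their slots down by one. *)
Lemma D_bind (P : (nat -> M) -> M -> Prop) :
  D (fun e => P (fun n => e (S n)) (e 0)) ->
  exists p s, forall e x, sat M (scons x (fun n => val e (s n))) p <-> P e x.
Proof.
  intros (p & s & H).
  exists (rename (fun n => match s n with inl O => O | _ => S n end) p),
    (fun n => match s n with inl (S i) => inl i | t => t end).
  intros e x. rewrite <- (H (scons x e)).
  apply sat_rename; intros n.
  destruct (s n) as [[|i]|c] eqn:E; simpl; rewrite ?E; reflexivity.
Qed.

Lemma D_all (P : (nat -> M) -> M -> Prop) :
  D (fun e => P (fun n => e (S n)) (e 0)) -> D (fun e => forall x, P e x).
Proof.
  intros (p & s & H)%D_bind.
  exists (FAll p), s; intros e; simpl; split; intros K x; apply H, K.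
Qed.

Lemma D_ex (P : (nat -> M) -> M -> Prop) :
  D (fun e => P (fun n => e (S n)) (e 0)) -> D (fun e => exists x, P e x).
Proof.
  intros (p & s & H)%D_bind.
  exists (FEx p), s; intros e; simpl; split; intros [x K]; exists x; apply H, K.
Qed.

Lemma D_subst (P : (nat -> M) -> Prop) (r : nat -> nat + M) :
  D P -> D (fun e => P (fun n => val e (r n))).
Proof.
  intros (p & s & H).
  exists p, (fun n => match s n with inl i => r i | t => t end).
  intros e; rewrite <- (H (fun n => val e (r n))).
  (* Renaming by the identity replaces an assignment by a pointwise equal one. *)
  etransitivity; [symmetry; apply (sat_rename M p (fun n => n)); reflexivity|].
  apply sat_rename; intros n; destruct (s n); reflexivity.
Qed.

Lemma D_inst1 (P : M -> Prop) : D (fun e => P (e 0)) ->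
  forall t, Tm t -> D (fun e => P (t e)).
Proof.
  intros H t [i|c].
  - exact (D_subst _ (fun _ => inl i) H).
  - exact (D_subst _ (fun _ => inr c) H).
Qed.

Lemma D_inst2 (R : M -> M -> Prop) : D (fun e => R (e 0) (e 1)) ->
  forall t u, Tm t -> Tm u -> D (fun e => R (t e) (u e)).
Proof.
  intros H t u [i|c] [j|d];
    [pose (r := fun n => match n with O => inl i | _ => inl j end : nat + M)
    |pose (r := fun n => match n with O => inl i | _ => inr d end : nat + M)
    |pose (r := fun n => match n with O => inr c | _ => inl j end : nat + M)
    |pose (r := fun n => match n with O => inr c | _ => inr d end : nat + M)];
    exact (D_subst _ r H).
Qed.

End Definability.

(** * Automatic proofs of definability *)

Ltac dfn_unfold :=
  progress unfold unique, is_set, subset, is_atoms, is_empty, is_succ, is_upair,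
    is_opair, is_fun_on, is_fun, is_bij, is_comp, transitive, is_ordinal,
    equinumerous, is_natural, in_Sym, perm_group, subgroup, is_stab, atom_seq_lt,
    is_automorphism, is_kappa_structure.

Ltac dfn_leaf := first [apply Tm_var | apply Tm_const].

Ltac dfn_lib := fail.

(** Hypotheses and the lemmas in [dfn_lib] are tried before the connectives, and unfolding comes
    last, so that a notion with its own lemma is not taken apart again. The case [context [Tm]] uses
    definability lemmas that have been put into the context. *)
Ltac dfn :=
  cbv beta;
  lazymatch goal with
  | |- Tm _ => dfn_leaf
  | |- D _ =>
    first
      [ assumption
      | match goal with
        | H : D (fun e => ?R (e 0) (e 1)) |- _ => apply (D_inst2 R H); dfn
        | H : D (fun e => ?P (e 0)) |- _ => apply (D_inst1 P H); dfn
        | H : context [Tm] |- _ => apply H; dfn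
        end
      | dfn_lib; dfn
      | apply D_and; dfn
      | apply D_or; dfn
      | apply D_iff; dfn
      | apply D_not; dfn
      | apply D_ex; dfn
      | apply D_imp; dfn
      | apply D_all; dfn
      | apply D_mem; dfn_leaf
      | apply D_eq; dfn_leaf
      | apply D_atom; dfn_leaf
      | dfn_unfold; dfn ]
  end.

Lemma D_opair {M : structure} (t u v : (nat -> M) -> M) : Tm t -> Tm u -> Tm v ->
  D (fun e => is_opair (t e) (u e) (v e)).
Proof. intros [] [] []; dfn. Qed.

Ltac dfn_lib ::= apply D_opair.

Lemma D_maps {M : structure} (t u v : (nat -> M) -> M) : Tm t -> Tm u -> Tm v ->
  D (fun e => maps (t e) (u e) (v e)).
Proof. intros [] [] []; unfold maps; dfn. Qed.

Ltac dfn_lib ::= first [apply D_opair | apply D_maps].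

Lemma D_is_fun_on {M : structure} (t u : (nat -> M) -> M) : Tm t -> Tm u ->
  D (fun e => is_fun_on (t e) (u e)).
Proof. intros [] []; dfn. Qed.

Lemma D_is_fun {M : structure} (t u v : (nat -> M) -> M) : Tm t -> Tm u -> Tm v ->
  D (fun e => is_fun (t e) (u e) (v e)).
Proof. intros [] [] []; dfn. Qed.

Lemma D_acts {M : structure} (t u v : (nat -> M) -> M) : Tm t -> Tm u -> Tm v ->
  D (fun e => acts (t e) (u e) (v e)).
Proof. intros [] [] []; unfold acts; dfn. Qed.

Ltac dfn_lib ::=
  first [apply D_opair | apply D_maps | apply D_is_fun_on | apply D_is_fun | apply D_acts].

(** * Basic set theory with atoms *)

Section Sets.
Context {M : structure} (Z : ZFA M).

Lemma set_ext (x y : M) : is_set x -> is_set y -> (forall z, z ∈ x <-> z ∈ y) -> x = y.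
Proof. apply (zfa_extensionality Z). Qed.

Lemma mem_set (x y : M) : x ∈ y -> is_set y.
Proof. intros H K; exact (zfa_atoms_empty Z _ _ K H). Qed.

Lemma separation (P : M -> Prop) (x : M) : D (fun e => P (e 0)) ->
  exists y, is_set y /\ forall z, z ∈ y <-> z ∈ x /\ P z.
Proof.
  intros HD; apply (D_bind (fun _ => P)) in HD as (p & s & H).
  (* The slots may be filled with anything, since [P] reads only the bound one; [x] is merely an
     element at hand. *)
  destruct (zfa_separation Z p (fun n => val (fun _ => x) (s n)) x) as (y & Hy & K).
  exists y; split; [assumption|]; intros z; rewrite K, H; tauto.
Qed.

Lemma replacement (R : M -> M -> Prop) (x : M) : D (fun e => R (e 0) (e 1)) ->
  (forall u v w, u ∈ x -> R u v -> R u w -> v = w) ->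
  exists y, is_set y /\ forall v, v ∈ y <-> exists u, u ∈ x /\ R u v.
Proof.
  intros (p & s & H) F.
  set (e := fun n => val (fun _ => x) (s n)).
  (* In [zfa_replacement] the value is variable 0 and the argument variable 1, the reverse of their
     slots in [R (e 0) (e 1)]. *)
  set (r := fun n => match s n with inl O => 1 | inl (S O) => 0 | _ => S (S n) end).
  assert (K : forall u v, sat M (scons v (scons u e)) (rename r p) <-> R u v).
  { intros u v; rewrite <- (H (scons u (scons v (fun _ => x)))); simpl.
    apply sat_rename; intros n; unfold r, e.
    destruct (s n) as [[|[|i]]|c] eqn:E; simpl; rewrite ?E; reflexivity. }
  destruct (zfa_replacement Z (rename r p) e x) as (y & Hy & L).
  - intros u v w; rewrite !K; apply F.
  - exists y; split; [assumption|]; intros v; rewrite L.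
    split; intros (u & Hu & Q); exists u; (split; [assumption|]); apply K; assumption.
Qed.

Lemma foundation (P : M -> Prop) (t x : M) : D (fun e => P (e 0)) ->
  x ∈ t -> P x -> exists y, y ∈ t /\ P y /\ forall z, z ∈ t -> z ∈ y -> ~ P z.
Proof.
  intros HD Hx HP.
  destruct (separation P t HD) as (s & _ & Hs).
  destruct (zfa_foundation Z s) as (y & Hy & K).
  { exists x; apply Hs; auto. }
  apply Hs in Hy as [Hy Py]; exists y; repeat split; auto.
  intros z Hz Hzy Pz; apply (K z); [apply Hs; auto|assumption].
Qed.

(* The clause on [T] in [acts] and in [is_TC] makes this hold wherever it is
   needed, which avoids constructing transitive closures. *)
Definition tr (x : M) : Prop := exists t, transitive t /\ x ∈ t.

Lemma tr_mem (x u : M) : tr x -> u ∈ x -> tr u.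
Proof. intros (t & Ht & Hx) Hu; exists t; split; [assumption|]. eapply Ht; eauto. Qed.

(** A minimal counterexample is sought in a transitive set containing [x]; all its members lie in
    that set too, hence satisfy [P]. *)
Lemma tr_ind (P : M -> Prop) : D (fun e => P (e 0)) ->
  (forall x, tr x -> (forall u, u ∈ x -> P u) -> P x) -> forall x, tr x -> P x.
Proof.
  intros HD IH x (t & Ht & Hx); apply NNPP; intros N.
  destruct (foundation (fun z => ~ P z) t x) as (y & Hy & Py & K); auto.
  { dfn. }
  apply Py, IH; [exists t; auto|].
  intros u Hu; apply NNPP; apply K; [|assumption]. eapply Ht; eauto.
Qed.

(** * Pairs, unions and the absence of membership cycles *)

Lemma upair_ex (x y : M) : exists p, is_upair p x y.
Proof. apply (zfa_pairing Z). Qed.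

Lemma upair_unique (p q x y : M) : is_upair p x y -> is_upair q x y -> p = q.
Proof.
  intros [Hp Kp] [Hq Kq]; apply set_ext; auto. intros z; rewrite Kp, Kq; tauto.
Qed.

Lemma upair_inj (p x y x' y' : M) : is_upair p x y -> is_upair p x' y' ->
  (x = x' /\ y = y') \/ (x = y' /\ y = x').
Proof.
  intros [_ K] [_ L].
  assert (A1 : x ∈ p) by (apply K; auto).
  assert (A2 : y ∈ p) by (apply K; auto).
  assert (A3 : x' ∈ p) by (apply L; auto).
  assert (A4 : y' ∈ p) by (apply L; auto).
  apply L in A1, A2; apply K in A3, A4.
  intuition congruence.
Qed.

Lemma opair_ex (x y : M) : exists p, is_opair p x y.
Proof.
  destruct (upair_ex x x) as [s Hs], (upair_ex x y) as [d Hd], (upair_ex s d) as [p Hp].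
  exists p, s, d; auto.
Qed.

Lemma opair_unique (p q x y : M) : is_opair p x y -> is_opair q x y -> p = q.
Proof.
  intros (s & d & Hs & Hd & Hp) (s' & d' & Hs' & Hd' & Hp').
  rewrite (upair_unique _ _ _ _ Hs' Hs), (upair_unique _ _ _ _ Hd' Hd) in Hp'.
  eapply upair_unique; eauto.
Qed.

Lemma opair_inj (p x y x' y' : M) : is_opair p x y -> is_opair p x' y' -> x = x' /\ y = y'.
Proof.
  intros (s & d & Hs & Hd & Hp) (s' & d' & Hs' & Hd' & Hp').
  destruct (upair_inj _ _ _ _ _ Hp Hp') as [[-> ->]|[-> ->]].
  - destruct (upair_inj _ _ _ _ _ Hs Hs'), (upair_inj _ _ _ _ _ Hd Hd');
      intuition congruence.
  - destruct (upair_inj _ _ _ _ _ Hs Hd'), (upair_inj _ _ _ _ _ Hd Hs');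
      intuition congruence.
Qed.

Lemma cup_ex (x y : M) : exists u, is_set u /\ forall z, z ∈ u <-> z ∈ x \/ z ∈ y.
Proof.
  destruct (upair_ex x y) as (p & Hp & K).
  destruct (zfa_union Z p) as (u & Hu & L).
  exists u; split; [assumption|]; intros z; rewrite L; split.
  - intros (w & Hw & Hz); apply K in Hw as [->| ->]; auto.
  - intros [H|H]; [exists x|exists y]; rewrite K; auto.
Qed.

Lemma mem_irrefl (x : M) : ~ x ∈ x.
Proof.
  intros H. destruct (foundation (fun z => z = x) x x) as (y & Hy & -> & K); auto.
  { dfn. }
  apply (K x); auto.
Qed.

Lemma mem_asym (x y : M) : x ∈ y -> ~ y ∈ x.
Proof.
  intros H H'. destruct (upair_ex x y) as (p & Hp & K).
  destruct (zfa_foundation Z p) as (z & Hz & L).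
  { exists x; apply K; auto. }
  apply K in Hz as [->| ->].
  - apply (L y); auto. apply K; auto.
  - apply (L x); auto. apply K; auto.
Qed.

Lemma mem_asym3 (x y z : M) : x ∈ y -> y ∈ z -> ~ z ∈ x.
Proof.
  intros H H' H''. destruct (upair_ex x y) as (p & Hp & K).
  destruct (upair_ex z z) as (q & Hq & Kq).
  destruct (cup_ex p q) as (c & Hc & Kc).
  assert (A : forall w, w ∈ c <-> w = x \/ w = y \/ w = z).
  { intros w; rewrite Kc, K, Kq; tauto. }
  destruct (zfa_foundation Z c) as (w & Hw & L).
  { exists x; apply A; auto. }
  apply A in Hw as [->|[->| ->]].
  - apply (L z); auto. apply A; auto.
  - apply (L x); auto. apply A; auto.
  - apply (L y); auto. apply A; auto.
Qed.

(** * Functions as sets of pairs *)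

Lemma maps_dom (f X x y : M) : is_fun_on f X -> maps f x y -> x ∈ X.
Proof.
  intros (_ & _ & H & _) (p & Hp & Hf).
  destruct (H p Hf) as (x' & y' & Hx & Hp').
  destruct (opair_inj _ _ _ _ _ Hp Hp'); subst; assumption.
Qed.

Lemma maps_fun (f X x y y' : M) : is_fun_on f X -> maps f x y -> maps f x y' -> y = y'.
Proof.
  intros H K L. assert (Hx := maps_dom _ _ _ _ H K).
  destruct H as (_ & _ & _ & H). destruct (H x Hx) as (w & _ & Hw).
  transitivity w; [symmetry|]; apply Hw; assumption.
Qed.

Lemma maps_total (f X x : M) : is_fun_on f X -> x ∈ X -> exists y, maps f x y.
Proof.
  intros (_ & _ & _ & H) Hx. destruct (H x Hx) as (w & Hw & _); eauto.
Qed.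

Lemma fun_ext (f g X Y : M) : is_fun_on f X -> is_fun_on g Y ->
  (forall x y, maps f x y <-> maps g x y) -> f = g.
Proof.
  intros Hf Hg K; apply set_ext; [apply Hf|apply Hg|].
  assert (A : forall f g X : M, is_fun_on f X -> (forall x y, maps f x y -> maps g x y) ->
    forall z, z ∈ f -> z ∈ g).
  { clear f g X Y Hf Hg K; intros f g X Hf K z Hz.
    destruct Hf as (_ & _ & H & _); destruct (H z Hz) as (x & y & Hx & Hp).
    destruct (K x y) as (q & Hq & Hg); [exists z; auto|].
    rewrite (opair_unique _ _ _ _ Hp Hq); assumption. }
  intros z; split; eapply A; eauto; apply K.
Qed.

(** The graph is the image of [X] under the map taking x to the pair (x, y) with [R x y], so
    Replacement yields it without a set bounding the values. *)
Lemma fun_ex (R : M -> M -> Prop) (X : M) : D (fun e => R (e 0) (e 1)) -> is_set X ->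
  (forall x, x ∈ X -> exists! y, R x y) ->
  exists f, is_fun_on f X /\ forall x y, maps f x y <-> x ∈ X /\ R x y.
Proof.
  intros HD HX H.
  destruct (replacement (fun x p => exists y, R x y /\ is_opair p x y) X)
    as (f & Hf & K).
  { dfn. }
  { intros u p q Hu (y & Hy & Hp) (z & Hz & Hq).
    destruct (H u Hu) as (w & _ & Hw).
    rewrite <- (Hw _ Hy) in Hp; rewrite <- (Hw _ Hz) in Hq.
    eapply opair_unique; eauto. }
  assert (Km : forall x y, maps f x y <-> x ∈ X /\ R x y).
  { intros x y; split.
    - intros (p & Hp & Hpf); apply K in Hpf as (x' & Hx' & y' & Hy' & Hp').
      destruct (opair_inj _ _ _ _ _ Hp Hp'); subst; auto.
    - intros [Hx Hy]; destruct (opair_ex x y) as [p Hp].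
      exists p; split; [assumption|]; apply K; eauto. }
  exists f; split; [|assumption].
  repeat split; auto.
  - intros p Hp; apply K in Hp as (x & Hx & y & _ & Hp); eauto.
  - intros x Hx; destruct (H x Hx) as (y & Hy & Hu).
    exists y; split; [apply Km; auto|]; intros z Hz; apply Hu, Km; assumption.
Qed.

Lemma tr_atom (a : M) : atom a -> tr a.
Proof.
  intros Ha; destruct (zfa_atoms_set Z) as (A & HA & K).
  exists A; split; [split; [assumption|]|apply K, Ha].
  intros x y Hx Hy; apply K in Hx; destruct (mem_set _ _ Hy Hx).
Qed.

Lemma atoms_unique (A B : M) : is_atoms A -> is_atoms B -> A = B.
Proof.
  intros [HA KA] [HB KB]; apply set_ext; auto; intros z; rewrite KA, KB; tauto.
Qed.

Lemma succ_ex (x : M) : exists y, is_succ y x.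
Proof.
  destruct (upair_ex x x) as (s & _ & Hs), (cup_ex x s) as (y & Hy & K).
  exists y; split; [assumption|]; intros z; rewrite K, Hs; tauto.
Qed.

Lemma succ_unique (y z x : M) : is_succ y x -> is_succ z x -> y = z.
Proof.
  intros [Hy Ky] [Hz Kz]; apply set_ext; auto; intros w; rewrite Ky, Kz; tauto.
Qed.

Lemma succ_inj (y x z : M) : is_succ y x -> is_succ y z -> x = z.
Proof.
  intros [_ Kx] [_ Kz].
  assert (A1 : x ∈ y) by (apply Kx; auto).
  assert (A2 : z ∈ y) by (apply Kz; auto).
  apply Kz in A1 as [A1|]; [|assumption]; apply Kx in A2 as [A2|]; [|auto].
  destruct (mem_asym _ _ A1 A2).
Qed.

End Sets.

Ltac tr_induction x Hx :=
  pattern x;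
  lazymatch goal with
  | Z : ZFA _ |- ?P x => refine (tr_ind Z P _ _ x Hx); clear x Hx; [dfn|cbv beta]
  end.

(** * Membership recursion *)

Section Recursion.
Context {M : structure} (Z : ZFA M) (step : M -> (M -> M -> Prop) -> M -> Prop).

(** A formula cannot quantify over relations, so definability is asked only for relations [maps f]
    with [f] in [M], the only ones to which [rec] applies [step]. *)
Hypothesis step_D : forall t u v : (nat -> M) -> M, Tm t -> Tm u -> Tm v ->
  D (fun e => step (t e) (maps (u e)) (v e)).
Hypothesis step_local : forall x (R R' : M -> M -> Prop) y,
  (forall u v, u ∈ x -> (R u v <-> R' u v)) -> step x R y -> step x R' y.
Hypothesis step_fun : forall x R y y', step x R y -> step x R y' -> y = y'.
Hypothesis step_total : forall x R, D (fun e => R (e 0) (e 1)) ->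
  (forall u, u ∈ x -> exists! v, R u v) -> exists y, step x R y.

(** Recursion through attempts: [f] is a partial solution on a transitive set. The shape is that of
    [acts], which therefore is an instance by conversion. *)
Definition rec (x y : M) : Prop :=
  exists T f, transitive T /\ x ∈ T /\ is_fun_on f T /\
    (forall z w, maps f z w -> step z (maps f) w) /\ maps f x y.

Lemma D_rec (t u : (nat -> M) -> M) : Tm t -> Tm u -> D (fun e => rec (t e) (u e)).
Proof.
  intros [] []; unfold rec; dfn.
Qed.

Lemma rec_tr (x y : M) : rec x y -> tr x.
Proof. intros (T & f & HT & Hx & _); exists T; auto. Qed.

Lemma rec_down (x y u : M) : rec x y -> u ∈ x -> exists v, rec u v.
Proof.
  intros (T & f & HT & Hx & Hf & Hs & Hm) Hu.
  assert (HuT : u ∈ T) by (eapply HT; eauto).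
  destruct (maps_total _ _ _ Hf HuT) as [v Hv].
  exists v, T, f; auto.
Qed.

Lemma rec_fun (x y y' : M) : rec x y -> rec x y' -> y = y'.
Proof.
  intros (T & f & HT & Hx & Hf & Hs & Hm) (T' & f' & HT' & Hx' & Hf' & Hs' & Hm').
  cut (x ∈ T -> x ∈ T' -> forall w w', maps f x w -> maps f' x w' -> w = w'); [eauto|].
  assert (HX : tr x) by (exists T; auto).
  clear Hm Hm' y y' Hx Hx'; tr_induction x HX.
  intros x _ IH Hx Hx' w w' Hw Hw'.
  apply (step_fun x (maps f)); [auto|].
  apply (step_local x (maps f')); [|auto].
  intros u v Hu.
  assert (HuT : u ∈ T) by (eapply HT; eauto).
  assert (HuT' : u ∈ T') by (eapply HT'; eauto).
  destruct (maps_total _ _ _ Hf HuT) as [a Ha], (maps_total _ _ _ Hf' HuT') as [b Hb].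
  assert (E : a = b) by (eapply IH; eauto); subst b.
  split; intros K.
  - rewrite (maps_fun _ _ _ _ _ Hf' K Hb); assumption.
  - rewrite (maps_fun _ _ _ _ _ Hf K Ha); assumption.
Qed.

Lemma rec_step (x y : M) : rec x y -> step x rec y.
Proof.
  intros (T & f & HT & Hx & Hf & Hs & Hm).
  apply (step_local x (maps f)); [|auto].
  intros u v Hu.
  assert (HuT : u ∈ T) by (eapply HT; eauto).
  assert (A : forall v, maps f u v -> rec u v) by (intros w Hw; exists T, f; auto).
  split; [apply A|]; intros K.
  destruct (maps_total _ _ _ Hf HuT) as [a Ha].
  rewrite (rec_fun _ _ _ K (A _ Ha)); assumption.
Qed.

(** An attempt on [T] is assembled from the values already known and the new value [w0] at [x].
    Arguing by contradiction pays off here: if [x] has no value, it is a member of no element of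
    [T], by [rec_down] and irreflexivity, so the value [w0] does not disturb the recursion clause
    elsewhere. *)
Lemma rec_total (x : M) : tr x -> exists y, rec x y.
Proof.
  (* Put into the context for [dfn], which proves the definability of the induction predicate. *)
  assert (HD := D_rec).
  intros X0; tr_induction x X0.
  intros x (t & Ht & Hx) IH.
  destruct (step_total x rec) as [w0 Hw0].
  { apply D_rec; dfn. }
  { intros u Hu; destruct (IH u Hu) as [v Hv]; exists v; split; [assumption|].
    intros v' Hv'; eapply rec_fun; eauto. }
  apply NNPP; intros N.
  destruct (separation Z (fun z => z = x \/ exists y, rec z y) t) as (T & HT & KT).
  { apply D_or; [dfn|]; apply D_ex; cbv beta; apply D_rec; dfn. }
  assert (TT : transitive T).
  { split; [assumption|]; intros z u Hz Hu; apply KT in Hz as [Hz Kz]; apply KT.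
    split; [eapply Ht; eauto|]; right.
    destruct Kz as [->|[y Hy]]; [auto|]; eapply rec_down; eauto. }
  destruct (fun_ex Z (fun z w => (z <> x /\ rec z w) \/ (z = x /\ w = w0)) T)
    as (f & Hf & Kf).
  { apply D_or; [apply D_and; [dfn|apply D_rec; dfn]|dfn]. }
  { assumption. }
  { intros z Hz; destruct (classic (z = x)) as [->|Hzx].
    - exists w0; split; [auto|]; intros w' [[? ?]|[_ ?]]; congruence.
    - apply KT in Hz as [_ [?|[y Hy]]]; [contradiction|].
      exists y; split; [auto|]; intros w' [[_ K]|[? _]]; [|contradiction].
      eapply rec_fun; eauto. }
  apply N; exists w0, T, f; split; [assumption|]; split; [apply KT; auto|].
  split; [assumption|]; split; [|apply Kf; split; [apply KT|]; auto].
  intros z w Hzw; apply Kf in Hzw as [HzT Hzw].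
  apply (step_local z rec).
  - intros u v Hu; rewrite Kf.
    assert (HuT : u ∈ T) by (eapply TT; eauto).
    assert (Hux : u <> x).
    { intros ->; destruct Hzw as [[_ K]|[-> _]].
      - apply N; eapply rec_down; eauto.
      - eapply (mem_irrefl Z); eauto. }
    tauto.
  - destruct Hzw as [[_ K]|[-> ->]]; [apply rec_step|]; assumption.
Qed.

Lemma rec_iff (x y : M) : tr x -> (rec x y <-> step x rec y).
Proof.
  intros Hx; split; [apply rec_step|]; intros H.
  destruct (rec_total x Hx) as [y' H'].
  rewrite (step_fun x rec y y'); auto using rec_step.
Qed.

End Recursion.

(** * The action of permutations on the universe *)

Section Action.
Context {M : structure} (Z : ZFA M).

Definition act_step (pi x : M) (R : M -> M -> Prop) (y : M) : Prop :=
  (atom x -> maps pi x y) /\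
  (is_set x -> is_set y /\ forall v, v ∈ y <-> exists u, u ∈ x /\ R u v).

Lemma in_Sym_maps (pi a b : M) : in_Sym pi -> maps pi a b -> atom a /\ atom b.
Proof.
  intros (A & [HA KA] & [[Hf [_ Hc]] _]) Hm; split; apply KA.
  - eapply maps_dom; eauto.
  - eapply Hc; eauto.
Qed.

Lemma in_Sym_fun (pi a b c : M) : in_Sym pi -> maps pi a b -> maps pi a c -> b = c.
Proof. intros (A & _ & [[Hf _] _]); eapply maps_fun; eauto. Qed.

Lemma in_Sym_inj (pi a b c : M) : in_Sym pi -> maps pi a c -> maps pi b c -> a = b.
Proof.
  intros (A & [HA KA] & [[Hf [_ Hc]] Hi]) H K.
  destruct (Hi c) as (d & _ & Hd); [eapply Hc; eauto|].
  rewrite <- (Hd _ H); apply Hd, K.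
Qed.

Lemma in_Sym_total (pi a : M) : in_Sym pi -> atom a -> exists b, maps pi a b.
Proof.
  intros (A & [HA KA] & [[Hf _] _]) Ha; eapply maps_total; eauto; apply KA, Ha.
Qed.

Lemma in_Sym_surj (pi b : M) : in_Sym pi -> atom b -> exists a, maps pi a b.
Proof.
  intros (A & [HA KA] & [_ Hi]) Hb; destruct (Hi b) as (a & Ha & _); [apply KA, Hb|eauto].
Qed.

Lemma acts_rec (pi x y : M) : acts pi x y <-> rec (act_step pi) x y.
Proof. reflexivity. Qed.

Lemma act_step_local (pi x : M) (R R' : M -> M -> Prop) (y : M) :
  (forall u v, u ∈ x -> (R u v <-> R' u v)) -> act_step pi x R y -> act_step pi x R' y.
Proof.
  intros E [H K]; split; [assumption|]; intros Hx; destruct (K Hx) as [Hy L].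
  split; [assumption|]; intros v; rewrite L.
  split; intros (u & Hu & Q); exists u; (split; [assumption|]); apply E; assumption.
Qed.

Lemma act_step_fun (pi x : M) R (y y' : M) : in_Sym pi ->
  act_step pi x R y -> act_step pi x R y' -> y = y'.
Proof.
  intros Hpi [H K] [H' K']; destruct (classic (atom x)) as [Hx|Hx].
  - eapply in_Sym_fun; eauto.
  - destruct (K Hx) as [A B], (K' Hx) as [A' B'].
    apply (set_ext Z); auto; intros z; rewrite B, B'; tauto.
Qed.

Lemma act_step_total (pi x : M) (R : M -> M -> Prop) : in_Sym pi ->
  D (fun e => R (e 0) (e 1)) ->
  (forall u, u ∈ x -> exists! v, R u v) -> exists y, act_step pi x R y.
Proof.
  intros Hpi HD H; destruct (classic (atom x)) as [Hx|Hx].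
  - destruct (in_Sym_total _ _ Hpi Hx) as [y Hy]; exists y; split; [auto|].
    intros K; destruct (K Hx).
  - destruct (replacement Z R x HD) as (y & Hy & K).
    { intros u v w Hu Hv Hw; destruct (H u Hu) as (r & _ & Hr).
      rewrite <- (Hr _ Hv); auto. }
    exists y; split; [contradiction|auto].
Qed.

Lemma act_step_D (pi : M) (t u v : (nat -> M) -> M) : Tm t -> Tm u -> Tm v ->
  D (fun e => act_step pi (t e) (maps (u e)) (v e)).
Proof. intros [] [] []; unfold act_step; dfn. Qed.

Hint Resolve act_step_D act_step_local act_step_fun act_step_total : core.

Lemma acts_fun (pi x y y' : M) : in_Sym pi -> acts pi x y -> acts pi x y' -> y = y'.
Proof. intros Hpi; apply (rec_fun Z (act_step pi)); eauto. Qed.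

Lemma acts_tr (pi x y : M) : acts pi x y -> tr x.
Proof. exact (rec_tr (act_step pi) x y). Qed.

Lemma acts_total (pi x : M) : in_Sym pi -> tr x -> exists y, acts pi x y.
Proof. intros Hpi; apply (rec_total Z (act_step pi)); eauto. Qed.

Lemma acts_atom (pi a b : M) : in_Sym pi -> atom a -> (acts pi a b <-> maps pi a b).
Proof.
  intros Hpi Ha; rewrite acts_rec, (rec_iff Z (act_step pi)); eauto using tr_atom.
  unfold act_step, is_set; tauto.
Qed.

Lemma acts_set (pi x y : M) : in_Sym pi -> is_set x -> tr x ->
  (acts pi x y <-> is_set y /\ forall v, v ∈ y <-> exists u, u ∈ x /\ acts pi u v).
Proof.
  intros Hpi Hs Hx; rewrite acts_rec, (rec_iff Z (act_step pi)); eauto.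
  unfold act_step; split; [intros [_ H]; auto|intros H; split; auto].
  intros Ha; destruct (Hs Ha).
Qed.

(** The image of the domain of the witness is transitive: a member of f(z) is f(u) for some u in z,
    and atoms go to atoms, which have no members. *)
Lemma acts_tr_image (pi x y : M) : in_Sym pi -> acts pi x y -> tr y.
Proof.
  intros Hpi (T & f & HT & Hx & Hf & Hs & Hm).
  destruct (replacement Z (fun u v => maps f u v) T) as (T' & HT' & K).
  { dfn. }
  { intros; eapply maps_fun; eauto. }
  exists T'; split; [|apply K; eauto].
  split; [assumption|]; intros w v Hw Hv; apply K in Hw as (z & Hz & Hzw).
  destruct (Hs _ _ Hzw) as [A B]; destruct (classic (atom z)) as [Ha|Ha].
  - apply A in Ha as Q; destruct (in_Sym_maps _ _ _ Hpi Q) as [_ Q'].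
    destruct (mem_set Z _ _ Hv Q').
  - apply (proj2 (B Ha)) in Hv as (u & Hu & Huv); apply K; exists u; split; auto.
    eapply HT; eauto.
Qed.

Lemma acts_mem (pi x y u v : M) : in_Sym pi -> acts pi x y -> u ∈ x -> acts pi u v -> v ∈ y.
Proof.
  intros Hpi H Hu Hv. apply (acts_set pi x y Hpi) in H; [|eapply mem_set; eauto|eapply acts_tr; eauto].
  apply H; eauto.
Qed.

(** The identity on [T] satisfies the clauses of [acts]. *)
Lemma acts_fix (pi T x : M) : transitive T -> x ∈ T ->
  (forall a, a ∈ T -> atom a -> maps pi a a) -> acts pi x x.
Proof.
  intros HT Hx H.
  destruct (fun_ex Z (fun u v => u = v) T) as (f & Hf & K).
  { dfn. }
  { apply HT. }
  { intros u _; exists u; split; auto. }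
  exists T, f; repeat (split; [solve [auto]|]); split; [|apply K; auto].
  intros z w Hz; apply K in Hz as [Hz <-]; split; [auto|].
  intros Hs; split; [assumption|]; intros v; split.
  - intros Hv; exists v; split; [assumption|]; apply K; split; [eapply HT; eauto|auto].
  - intros (u & Hu & Q); apply K in Q as [_ <-]; assumption.
Qed.

Lemma acts_comp (pi sg rho x y z : M) : in_Sym pi -> in_Sym sg -> in_Sym rho ->
  is_comp rho pi sg -> acts sg x y -> acts pi y z -> acts rho x z.
Proof.
  intros Hpi Hsg Hrho C H; assert (Hx := acts_tr _ _ _ H).
  revert x Hx y z H; apply (tr_ind Z (fun x => forall y z, acts sg x y -> acts pi y z -> acts rho x z)).
  { dfn. }
  intros x Hx IH y z H K; destruct (classic (atom x)) as [Ha|Ha].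
  - apply acts_atom in H; auto; destruct (in_Sym_maps _ _ _ Hsg H) as [_ Hy].
    apply acts_atom in K; auto; apply acts_atom; auto; apply C; eauto.
  - assert (Hy := acts_tr _ _ _ K).
    apply acts_set in H as [Sy H]; auto; apply acts_set in K as [Sz K]; auto.
    apply acts_set; auto; split; [assumption|]; intros v; rewrite K; split.
    + intros (w & Hw & Hv); apply H in Hw as (u & Hu & Huw); eauto.
    + intros (u & Hu & Huv).
      destruct (acts_total sg u Hsg (tr_mem _ _ Hx Hu)) as [w Hw].
      assert (Hwy : w ∈ y) by (apply H; eauto).
      destruct (acts_total pi w Hpi (tr_mem _ _ Hy Hwy)) as [v' Hv'].
      exists w; split; [assumption|].
      rewrite (acts_fun rho u v v'); eauto.
Qed.

Lemma acts_inv (pi rho x y : M) : in_Sym pi -> in_Sym rho ->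
  (forall a b, maps rho a b <-> maps pi b a) -> acts pi x y -> acts rho y x.
Proof.
  intros Hpi Hrho C H; assert (Hx := acts_tr _ _ _ H).
  revert x Hx y H; apply (tr_ind Z (fun x => forall y, acts pi x y -> acts rho y x)).
  { dfn. }
  intros x Hx IH y H; assert (Hy := acts_tr_image _ _ _ Hpi H).
  destruct (classic (atom x)) as [Ha|Ha].
  - apply acts_atom in H; auto; destruct (in_Sym_maps _ _ _ Hpi H) as [_ Ay].
    apply acts_atom; auto; apply C; auto.
  - apply acts_set in H as [Sy H]; auto.
    apply acts_set; auto; split; [assumption|]; intros v; split.
    + intros Hv; destruct (acts_total pi v Hpi (tr_mem _ _ Hx Hv)) as [w Hw].
      exists w; split; [apply H; eauto|auto].
    + intros (w & Hw & Hwv); apply H in Hw as (u & Hu & Huw).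
      rewrite (acts_fun rho w v u); auto.
Qed.

Lemma acts_upair (pi s s' x y x' y' : M) : in_Sym pi -> tr s ->
  is_upair s x y -> is_upair s' x' y' -> acts pi x x' -> acts pi y y' -> acts pi s s'.
Proof.
  intros Hpi Hs [Ss Ks] [Ss' Ks'] Hx Hy.
  apply acts_set; auto; split; [assumption|]; intros v; rewrite Ks'; split.
  - intros [->| ->]; [exists x|exists y]; rewrite Ks; auto.
  - intros (u & Hu & Huv); apply Ks in Hu as [->| ->]; [left|right];
      eapply acts_fun; eauto.
Qed.

Lemma acts_opair (pi p p' x y x' y' : M) : in_Sym pi -> tr p ->
  is_opair p x y -> is_opair p' x' y' -> acts pi x x' -> acts pi y y' -> acts pi p p'.
Proof.
  intros Hpi Hp (s & d & Hs & Hd & Hsd) (s' & d' & Hs' & Hd' & Hsd') Hx Hy.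
  assert (s ∈ p) by (apply Hsd; auto).
  assert (d ∈ p) by (apply Hsd; auto).
  eapply acts_upair; eauto; eapply acts_upair; eauto using tr_mem.
Qed.

(** Indices are ordinals, which have no atoms in their transitive closure and so are fixed; thus the
    pair (i, v) goes to (i, pi v), and uniqueness of values forces pi v = v. Conversely, the entries
    are the only atoms hereditarily in [a]. *)
Lemma acts_seq (pi a n A : M) : in_Sym pi -> is_atoms A -> is_ordinal n -> is_fun a n A ->
  (acts pi a a <-> forall i v, maps a i v -> maps pi v v).
Proof.
  intros Hpi [SA KA] [Tn [Sn _]] [Hf [_ Hc]]; split.
  - intros H i v Hm; assert (Ha := acts_tr _ _ _ H).
    assert (Av : atom v) by (apply KA; eapply Hc; eauto).
    assert (Hi := maps_dom _ _ _ _ Hf Hm).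
    destruct Hm as (p & Hp & Hpa).
    destruct (in_Sym_total pi v Hpi Av) as [w Hw].
    destruct (opair_ex Z i w) as [q Hq].
    assert (Hpq : acts pi p q).
    { eapply acts_opair; eauto using tr_mem.
      - apply (acts_fix pi n); auto. intros b Hb Ab; destruct (Sn b Hb Ab).
      - apply acts_atom; auto. }
    assert (Hqa : q ∈ a) by (eapply acts_mem; eauto).
    assert (E : w = v) by (apply (maps_fun a n i); [|exists q|exists p]; auto).
    subst; assumption.
  - intros H.
    (* [T] is the union of {a}, a, its first and second unions, and n. The two unions reach the
       components of the Kuratowski pairs, and n absorbs the indices, which makes [T] transitive. *)
    destruct (upair_ex Z a a) as (s & Ss & Ks).
    destruct (zfa_union Z a) as (u1 & _ & K1).
    destruct (zfa_union Z u1) as (u2 & _ & K2).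
    destruct (cup_ex Z s a) as (c1 & _ & L1).
    destruct (cup_ex Z u1 u2) as (c2 & _ & L2).
    destruct (cup_ex Z c1 c2) as (c3 & _ & L3).
    destruct (cup_ex Z c3 n) as (T & ST & LT).
    assert (KT : forall z, z ∈ T <-> z = a \/ z ∈ a \/ z ∈ u1 \/ z ∈ u2 \/ z ∈ n).
    { intros z; rewrite LT, L3, L1, L2, Ks; tauto. }
    assert (Pa : forall p, p ∈ a -> exists i v s d, i ∈ n /\ atom v /\ maps a i v /\
      is_upair s i i /\ is_upair d i v /\ is_upair p s d).
    { intros p Hp; destruct Hf as (_ & _ & Hf & _).
      destruct (Hf p Hp) as (i & v & Hi & Hq).
      assert (Hm : maps a i v) by (exists p; auto).
      destruct Hq as (s' & d' & ? & ? & ?); exists i, v, s', d'; repeat (split; auto).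
      apply KA; eauto. }
    assert (P1 : forall z, z ∈ u1 -> is_set z).
    { intros z Hz; apply K1 in Hz as (p & Hp & Hzp).
      destruct (Pa p Hp) as (i & v & s' & d' & _ & _ & _ & Hs & Hd & _ & Kp).
      apply Kp in Hzp as [->| ->]; [apply Hs|apply Hd]. }
    assert (P2 : forall z, z ∈ u2 -> z ∈ n \/ (atom z /\ maps pi z z)).
    { intros z Hz; apply K2 in Hz as (w & Hw & Hzw); apply K1 in Hw as (p & Hp & Hwp).
      destruct (Pa p Hp) as (i & v & s' & d' & Hi & Av & Hm & [_ Hs] & [_ Hd] & _ & Kp).
      apply Kp in Hwp as [->| ->]; [apply Hs in Hzw|apply Hd in Hzw];
        destruct Hzw as [->| ->]; eauto. }
    apply (acts_fix pi T); [|apply KT; auto|].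
    + split; [assumption|]; intros x y Hx Hy; apply KT in Hx; apply KT.
      destruct Hx as [->|[Hx|[Hx|[Hx|Hx]]]]; auto.
      * right; right; left; apply K1; eauto.
      * right; right; right; left; apply K2; eauto.
      * apply P2 in Hx as [Hx|[Hx _]]; [|destruct (mem_set Z _ _ Hy Hx)].
        do 4 right; eapply Tn; eauto.
      * do 4 right; eapply Tn; eauto.
    + intros b Hb Ab; apply KT in Hb as [->|[Hb|[Hb|[Hb|Hb]]]].
      * destruct (proj1 Hf Ab).
      * destruct (Pa b Hb) as (i & v & s' & d' & _ & _ & _ & _ & _ & Sb & _).
        destruct (Sb Ab).
      * destruct (P1 b Hb Ab).
      * apply P2 in Hb as [Hb|[_ Hb]]; [destruct (Sn b Hb Ab)|assumption].
      * destruct (Sn b Hb Ab).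
Qed.

End Action.

(** * Ordinals and merging of sequences *)

Section Ordinals.
Context {M : structure} (Z : ZFA M).

(** Linearity is inherited because [y] is a subset of [x]. For transitivity, [v] and [y] are
    compared inside [x]; the two unwanted outcomes give membership cycles of length two and
    three. *)
Lemma ordinal_mem (x y : M) : is_ordinal x -> y ∈ x -> is_ordinal y.
Proof.
  intros (Tx & Sx & Lx) Hy.
  assert (B : forall z, z ∈ y -> z ∈ x) by (intros z Hz; eapply Tx; eauto).
  split; [split; [auto|]|split; auto].
  intros u v Hu Hv.
  assert (Hvx : v ∈ x) by (apply (proj2 Tx) with u; auto).
  destruct (Lx v y Hvx Hy) as [K|[->|K]]; [assumption| |].
  - destruct (mem_asym Z _ _ Hu Hv).
  - destruct (mem_asym3 Z _ _ _ Hv Hu K).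
Qed.

Lemma ordinal_tr (x y : M) : is_ordinal x -> y ∈ x -> tr y.
Proof. intros [T _] H; exists x; auto. Qed.

(** When [d] is a proper subset, it equals the least member of [x] outside it. *)
Lemma transitive_subset_ordinal (d x : M) : transitive d -> subset d x -> is_ordinal x ->
  d = x \/ d ∈ x.
Proof.
  intros Td Hd (Tx & Sx & Lx).
  destruct (classic (exists z, z ∈ x /\ ~ z ∈ d)) as [(z0 & Hz0 & Nz0)|N].
  - right.
    destruct (foundation Z (fun z => ~ z ∈ d) x z0) as (z & Hz & Nz & K); auto; [dfn|].
    replace d with z; [assumption|].
    apply (set_ext Z); [auto|apply Td|]; intros w; split; intros Hw.
    + apply NNPP; apply K; [eapply Tx; eauto|assumption].
    + destruct (Lx w z (Hd _ Hw) Hz) as [?|[->|Q]]; [assumption|contradiction|].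
      destruct Nz; eapply Td; eauto.
  - left; apply (set_ext Z); [apply Td|apply Tx|]; intros w; split; [apply Hd|].
    intros Hw; apply NNPP; intros Nw; eauto.
Qed.

Lemma succ_ordinal (s x : M) : is_succ s x -> is_ordinal x -> is_ordinal s.
Proof.
  intros [Hs Ks] (Tx & Sx & Lx).
  assert (Hset : is_set x) by apply Tx.
  split; [split; [assumption|]|split].
  - intros u v Hu Hv; apply Ks; apply Ks in Hu as [Hu| ->]; left; [eapply Tx; eauto|auto].
  - intros u Hu; apply Ks in Hu as [Hu| ->]; auto.
  - intros u v Hu Hv; apply Ks in Hu as [Hu| ->]; apply Ks in Hv as [Hv| ->]; auto.
Qed.

Lemma natural_succ (s n : M) : is_succ s n -> is_natural n -> is_natural s.
Proof.
  intros Hs [On Hn]; split; [eapply succ_ordinal; eauto|].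
  intros m [Hm| ->]; [|eauto]. apply Hn, Hs, Hm.
Qed.

Lemma natural_mem (n m : M) : is_natural n -> m ∈ n -> is_natural m.
Proof.
  intros [On Hn] Hm; split; [eapply ordinal_mem; eauto|].
  intros l [Hl| ->]; apply Hn; left; [eapply (proj1 On); eauto|assumption].
Qed.

Lemma empty_natural (o : M) : is_empty o -> is_natural o.
Proof.
  intros [So Ho]; split.
  - split; [split; [assumption|]|split]; intros x; intros; exfalso; eapply Ho; eauto.
  - intros m [Hm| ->]; [destruct (Ho _ Hm)|left; split; assumption].
Qed.

Lemma natural_finite (n : M) : is_natural n -> is_finite n.
Proof.
  intros Hn; exists n; split; [assumption|].
  assert (Sn : is_set n) by exact (proj1 (proj1 (proj1 Hn))).
  destruct (fun_ex Z (fun x y => x = y) n) as (f & Hf & K); [dfn|assumption| |].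
  { intros x _; exists x; split; auto. }
  exists f; split; [split; [assumption|split; [assumption|]]|].
  - intros x y Hxy; apply K in Hxy as [Hx <-]; assumption.
  - intros y Hy; exists y; split; [apply K; auto|].
    intros z Hz; apply K in Hz as [_ ->]; reflexivity.
Qed.

(** Zero qualifies; that kappa is nonempty comes from [infinite_ordinal_nonempty]. *)
Definition limit (k : M) : Prop :=
  is_ordinal k /\ forall x, x ∈ k -> exists s, s ∈ k /\ is_succ s x.

Lemma infinite_ordinal_nonempty (k : M) : is_ordinal k -> ~ is_finite k ->
  exists o, o ∈ k /\ is_empty o.
Proof.
  intros (Tk & Sk & _) N.
  assert (H : exists x, x ∈ k).
  { apply NNPP; intros H; apply N, natural_finite, empty_natural; split; [apply Tk|].
    intros z Hz; eauto. }
  destruct (zfa_foundation Z k H) as (o & Ho & K).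
  exists o; split; [assumption|]; split; [auto|].
  intros z Hz; apply (K z); [eapply Tk; eauto|assumption].
Qed.

(* If [k = g + 1], then removing [g] from [k] and shifting the natural numbers
   up by one is a bijection from [k] to [g]; [f] below is its inverse. *)
Lemma infinite_cardinal_limit (k : M) : infinite_cardinal k -> limit k.
Proof.
  intros [[Ok Ck] Nf]; split; [assumption|]; intros g Hg.
  destruct (succ_ex Z g) as [s Hs]; exists s; split; [|assumption].
  assert (Tk := proj1 Ok).
  assert (Og := ordinal_mem _ _ Ok Hg).
  assert (Os := succ_ordinal _ _ Hs Og).
  (* A successor of [g] outside [k] would be [k] itself; it remains to contradict this by a
     bijection between [g] and [k]. *)
  destruct (transitive_subset_ordinal s k) as [->|]; auto.
  { exact (proj1 Os). }
  { intros z Hz; apply Hs in Hz as [Hz| ->]; [eapply Tk; eauto|assumption]. }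
  exfalso; apply (Ck g Hg).
  assert (Ng : ~ is_natural g).
  { intros K; apply Nf, natural_finite, (natural_succ _ _ Hs), K. }
  destruct (infinite_ordinal_nonempty k Ok Nf) as (o & Ho & Eo).
  (* The shift stays below [g], since [g] itself is not the successor of a natural number. *)
  assert (Hsg : forall n t, n ∈ g -> is_natural n -> is_succ t n -> t ∈ g).
  { intros n t Hn Nn Ht; destruct (transitive_subset_ordinal t g) as [->|]; auto.
    - apply (succ_ordinal _ _ Ht (proj1 Nn)).
    - intros z Hz; apply Ht in Hz as [Hz| ->]; [eapply (proj1 Og); eauto|assumption].
    - destruct Ng; eapply natural_succ; eauto. }
  assert (Hog : o ∈ g).
  { apply Hs in Ho as [Ho| ->]; [assumption|].
    destruct Ng; apply empty_natural, Eo. }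
  assert (Uo : forall x, is_empty x -> x = o).
  { intros x [Sx Kx]; destruct Eo as [So Ko]; apply (set_ext Z); auto.
    intros z; split; intros Hz; [destruct (Kx z Hz)|destruct (Ko z Hz)]. }
  set (R := fun x y => (is_empty x /\ y = g) \/ (is_natural x /\ is_succ x y) \/
                       (~ is_natural x /\ y = x)).
  assert (Suc0 : forall x y : M, is_empty x -> ~ is_succ x y).
  { intros x y [_ K] [_ L]; apply (K y), L; auto. }
  destruct (fun_ex Z R g) as (f & Hf & K).
  { unfold R; dfn. }
  { exact (proj1 (proj1 Og)). }
  { intros x Hx; destruct (classic (is_natural x)) as [Nx|Nx].
    - destruct (proj2 Nx x (or_intror eq_refl)) as [Ex|[l Hl]].
      + exists g; split; [left; auto|].
        intros y [[_ ?]|[[_ ?]|[? _]]]; [auto| |contradiction].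
        destruct (Suc0 x y); auto.
      + exists l; split; [right; left; auto|].
        intros y [[? _]|[[_ ?]|[? _]]]; [|eapply succ_inj; eauto|contradiction].
        destruct (Suc0 x l); auto.
    - exists x; split; [right; right; auto|].
      intros y [[? _]|[[? _]|[_ ?]]]; [|contradiction|auto].
      destruct Nx; apply empty_natural; assumption. }
  exists f; split; [split; [assumption|split; [apply Tk|]]|].
  - intros x y Hxy; apply K in Hxy as [Hx [[_ ->]|[[_ [_ Hy]]|[_ ->]]]]; auto.
    + apply (proj2 Tk) with x; [apply (proj2 Tk) with g|apply Hy]; auto.
    + apply (proj2 Tk) with g; auto.
  - intros y Hy; apply Hs in Hy as [Hy| ->].
    + destruct (classic (is_natural y)) as [Ny|Ny].
      * destruct (succ_ex Z y) as [t Ht]; exists t.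
        assert (Nt : is_natural t) by (eapply natural_succ; eauto).
        split; [apply K; split; [eapply Hsg; eauto|right; left; auto]|].
        intros x Hx; apply K in Hx as [Hx [[_ ->]|[[_ H]|[H ->]]]].
        -- destruct (mem_irrefl Z g Hy).
        -- apply (succ_unique Z _ _ _ Ht H).
        -- contradiction.
      * exists y; split; [apply K; split; [assumption|right; right; auto]|].
        intros x Hx; apply K in Hx as [Hx [[_ ->]|[[Nx [_ H]]|[H ->]]]].
        -- destruct (mem_irrefl Z g Hy).
        -- destruct Ny; apply (natural_mem x); [assumption|apply H; auto].
        -- reflexivity.
    + exists o; split; [apply K; split; [assumption|left; auto]|].
      intros x Hx; apply K in Hx as [Hx [[Ex _]|[[Nx [_ H]]|[H ->]]]].
      * symmetry; auto.
      * destruct Ng; apply (natural_mem x); [assumption|apply H; auto].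
      * destruct (mem_irrefl Z x Hx).
Qed.

(* [dbl x y] says that [y] is the ordinal product 2 · x, defined by
   2 · x = sup {2 · u + 2 : u < x}. *)
Definition dbl_step (x : M) (R : M -> M -> Prop) (y : M) : Prop :=
  is_set y /\ forall v, v ∈ y <->
    exists u d, u ∈ x /\ R u d /\ (v ∈ d \/ v = d \/ is_succ v d).

Definition dbl : M -> M -> Prop := rec dbl_step.

Lemma dbl_step_local (x : M) (R R' : M -> M -> Prop) (y : M) :
  (forall u v, u ∈ x -> (R u v <-> R' u v)) -> dbl_step x R y -> dbl_step x R' y.
Proof.
  intros E [Hy L]; split; [assumption|]; intros v; rewrite L.
  split; intros (u & d & Hu & Q & W); exists u, d; (split; [assumption|]); split; auto;
    apply E; assumption.
Qed.

Lemma dbl_step_fun (x : M) R (y y' : M) : dbl_step x R y -> dbl_step x R y' -> y = y'.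
Proof.
  intros [A B] [A' B']; apply (set_ext Z); auto; intros z; rewrite B, B'; tauto.
Qed.

Lemma dbl_step_total (x : M) (R : M -> M -> Prop) : D (fun e => R (e 0) (e 1)) ->
  (forall u, u ∈ x -> exists! v, R u v) -> exists y, dbl_step x R y.
Proof.
  intros HD H.
  (* Here [w] is d + 2, that is, d together with d and d + 1; the value sought is the union of these
     sets. *)
  destruct (replacement Z (fun u w => exists d, R u d /\ is_set w /\
    forall v, v ∈ w <-> v ∈ d \/ v = d \/ is_succ v d) x) as (c & _ & K).
  { dfn. }
  { intros u v w Hu (d & Hd & Sv & Kv) (d' & Hd' & Sw & Kw).
    destruct (H u Hu) as (r & _ & Hr).
    rewrite <- (Hr _ Hd) in Kv; rewrite <- (Hr _ Hd') in Kw.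
    apply (set_ext Z); auto; intros z; rewrite Kv, Kw; tauto. }
  destruct (zfa_union Z c) as (y & Hy & L); exists y; split; [assumption|].
  intros v; rewrite L; split.
  - intros (w & Hw & Hv); apply K in Hw as (u & Hu & d & Hd & _ & Kw).
    apply Kw in Hv; eauto.
  - intros (u & d & Hu & Hd & Hv).
    destruct (succ_ex Z d) as [s1 H1], (succ_ex Z s1) as [s2 H2].
    assert (Q : forall z, z ∈ s2 <-> z ∈ d \/ z = d \/ is_succ z d).
    { intros z; split.
      - intros Hz; apply H2 in Hz as [Hz| ->]; [apply H1 in Hz as [?|?]|]; auto.
      - intros [Hz|[->|Hz]]; apply H2; [left; apply H1; auto..|].
        right; apply (succ_unique Z _ _ _ Hz H1). }
    exists s2; split; [|apply Q, Hv]. apply K; exists u; split; [assumption|].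
    exists d; split; [assumption|]; split; [apply H2|assumption].
Qed.

Lemma dbl_step_D (t u v : (nat -> M) -> M) : Tm t -> Tm u -> Tm v ->
  D (fun e => dbl_step (t e) (maps (u e)) (v e)).
Proof. intros [] [] []; unfold dbl_step; dfn. Qed.

Lemma D_dbl (t u : (nat -> M) -> M) : Tm t -> Tm u -> D (fun e => dbl (t e) (u e)).
Proof. apply D_rec, dbl_step_D. Qed.

Lemma dbl_fun (x y y' : M) : dbl x y -> dbl x y' -> y = y'.
Proof.
  exact (rec_fun Z dbl_step dbl_step_local dbl_step_fun x y y').
Qed.

Lemma dbl_total (x : M) : tr x -> exists y, dbl x y.
Proof.
  exact (rec_total Z dbl_step dbl_step_D dbl_step_local dbl_step_fun dbl_step_total x).
Qed.

Lemma dbl_rec (x y : M) : dbl x y -> is_set y /\ forall v, v ∈ y <->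
  exists u d, u ∈ x /\ dbl u d /\ (v ∈ d \/ v = d \/ is_succ v d).
Proof.
  exact (rec_step Z dbl_step dbl_step_local dbl_step_fun x y).
Qed.

Lemma dbl_tr (x y : M) : dbl x y -> tr x.
Proof. exact (rec_tr dbl_step x y). Qed.

(** In ordinal terms, 2 · x + 2 is contained in 2 · y. Injectivity and parity both follow from
    this. *)
Lemma dbl_mono (x y dx dy : M) : x ∈ y -> dbl x dx -> dbl y dy ->
  forall v, (v ∈ dx \/ v = dx \/ is_succ v dx) -> v ∈ dy.
Proof. intros H Hx Hy v Hv; apply (dbl_rec y dy Hy); eauto. Qed.

Lemma dbl_transitive (x d : M) : dbl x d -> transitive d.
Proof.
  intros H; assert (Hx := dbl_tr _ _ H); revert d H.
  assert (HD := D_dbl).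
  tr_induction x Hx.
  intros x _ IH d H; destruct (dbl_rec x d H) as [Sd K]; split; [assumption|].
  intros w v Hw Hv; apply K in Hw as (u & e & Hu & He & Hw); apply K.
  exists u, e; split; [assumption|]; split; [assumption|].
  destruct Hw as [Hw|[->|Hw]]; [|auto|].
  - left; eapply (IH u); eauto.
  - apply Hw in Hv as [?|?]; auto.
Qed.

(** Induction on [x], for all limits [k] at once. If x = y + 1, then 2 · x = 2 · y + 2 and [k] is
    closed under successors. Otherwise [x] is itself a limit, so the induction hypothesis with [x]
    in the role of [k] puts every 2 · u with u < x below [x]; hence 2 · x is contained in [x]. *)
Lemma dbl_lt_limit (k x d : M) : limit k -> x ∈ k -> dbl x d -> d ∈ k.
Proof.
  intros Hk Hx H; assert (Tx := dbl_tr _ _ H).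
  revert d H k Hk Hx.
  assert (HD := D_dbl).
  unfold limit; tr_induction x Tx.
  intros x _ IH d H k [Ok Lk] Hx.
  destruct (dbl_rec x d H) as [Sd K].
  assert (Ox := ordinal_mem _ _ Ok Hx).
  destruct (classic (exists y, is_succ x y)) as [[y Hy]|N].
  - assert (Hyx : y ∈ x) by (apply Hy; auto).
    assert (Hyk : y ∈ k) by (eapply (proj1 Ok); eauto).
    destruct (dbl_total y (ordinal_tr _ _ Ok Hyk)) as [e He].
    assert (Hek : e ∈ k) by (eapply IH; eauto).
    destruct (Lk e Hek) as (s1 & Hs1 & S1); destruct (Lk s1 Hs1) as (s2 & Hs2 & S2).
    replace d with s2; [assumption|].
    apply (set_ext Z); [apply S2|assumption|]; intros v; split.
    + intros Hv; apply (dbl_mono y x e d Hyx He H); apply S2 in Hv as [Hv| ->]; auto.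
      apply S1 in Hv as [?|?]; auto.
    + intros Hv; apply K in Hv as (u & b & Hu & Hb & Hv).
      assert (Q : v ∈ e \/ v = e \/ is_succ v e).
      { apply Hy in Hu as [Hu| ->].
        - left; apply (dbl_mono u y b e); auto.
        - rewrite (dbl_fun _ _ _ He Hb); assumption. }
      apply S2; destruct Q as [Q|[->|Q]]; [left; apply S1; auto..|].
      right; apply (succ_unique Z _ _ _ Q S1).
  - assert (Lx : forall z, z ∈ x -> exists s, s ∈ x /\ is_succ s z).
    { intros z Hz; assert (Hzk : z ∈ k) by (eapply (proj1 Ok); eauto).
      destruct (Lk z Hzk) as (s & Hs & Ss); exists s; split; [|assumption].
      destruct (proj2 (proj2 Ok) s x Hs Hx) as [?|[->|Hxs]]; [assumption| |].
      - destruct N; eauto.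
      - apply Ss in Hxs as [Hxz| ->].
        + destruct (mem_asym Z _ _ Hz Hxz).
        + destruct (mem_irrefl Z _ Hz). }
    destruct (transitive_subset_ordinal d x) as [->|Hdx]; auto.
    + eapply dbl_transitive; eauto.
    + intros v Hv; apply K in Hv as (u & b & Hu & Hb & Hv).
      assert (Hbx : b ∈ x) by (eapply IH; eauto).
      destruct Hv as [Hv|[->|Hv]]; [eapply (proj1 Ox); eauto|assumption|].
      destruct (Lx b Hbx) as (s & Hs & Ss); rewrite (succ_unique Z _ _ _ Hv Ss); assumption.
    + eapply (proj1 Ok); eauto.
Qed.

Lemma dbl_inj (k x y d : M) : is_ordinal k -> x ∈ k -> y ∈ k ->
  dbl x d -> dbl y d -> x = y.
Proof.
  intros Ok Hx Hy Dx Dy; destruct (proj2 (proj2 Ok) x y Hx Hy) as [H|[H|H]]; auto;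
    destruct (mem_irrefl Z d).
  - apply (dbl_mono x y d d); auto.
  - apply (dbl_mono y x d d); auto.
Qed.

(** Keeps even and odd positions apart. By [dbl_mono], x < y would give s ∈ s, and y < x would give
    s ∈ d although d ∈ s. *)
Lemma dbl_parity (k x y d s : M) : is_ordinal k -> x ∈ k -> y ∈ k ->
  dbl x d -> is_succ s d -> ~ dbl y s.
Proof.
  intros Ok Hx Hy Dx Ss Dy.
  assert (Hds : d ∈ s) by (apply Ss; auto).
  destruct (proj2 (proj2 Ok) x y Hx Hy) as [H|[->|H]].
  - apply (mem_irrefl Z s), (dbl_mono x y d s); auto.
  - rewrite (dbl_fun _ _ _ Dx Dy) in Hds at 1; apply (mem_irrefl Z s Hds).
  - apply (mem_asym Z _ _ Hds), (dbl_mono y x s d); auto.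
Qed.

(* [c] interleaves: it takes the value [a(y)] at 2 · y and [b(y)] at 2 · y + 1. *)
Lemma merge_sequences (k A a n b m : M) : limit k ->
  n ∈ k -> is_fun a n A -> m ∈ k -> is_fun b m A ->
  exists c p, p ∈ k /\ is_fun c p A /\
    forall v, ((exists i, maps a i v) \/ (exists i, maps b i v)) -> exists j, maps c j v.
Proof.
  intros Lk Hn Ha Hm Hb; assert (Ok := proj1 Lk).
  (* [d0] is the default value at positions that neither sequence fills. If [A] is empty there is
     none, but then [b] has no entries and [a] itself will do. *)
  destruct (classic (exists v, v ∈ A)) as [[d0 Hd0]|NA].
  2:{ exists a, n; split; [assumption|]; split; [assumption|].
      intros v [H|[i Hi]]; [assumption|]. destruct NA; exists v; eapply Hb; eauto. }
  (* [q] is the larger of the two lengths, so 2 · q leaves room for both sequences. *)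
  assert (Q : exists q, q ∈ k /\ subset n q /\ subset m q).
  { destruct (proj2 (proj2 Ok) n m Hn Hm) as [H|[<-|H]].
    - exists m; split; [assumption|]; split; intros z Hz; auto.
      eapply (proj1 (ordinal_mem _ _ Ok Hm)); eauto.
    - exists n; split; [assumption|]; split; intros z Hz; auto.
    - exists n; split; [assumption|]; split; intros z Hz; auto.
      eapply (proj1 (ordinal_mem _ _ Ok Hn)); eauto. }
  destruct Q as (q & Hq & Hnq & Hmq).
  destruct (dbl_total q (ordinal_tr _ _ Ok Hq)) as [p Hp].
  assert (Hpk := dbl_lt_limit _ _ _ Lk Hq Hp).
  destruct Ha as [Ha [_ Ca]], Hb as [Hb [_ Cb]].
  assert (Dn : forall y v, maps a y v -> y ∈ k).
  { intros y v Hy; apply (proj1 Ok) with n; [assumption|]; eapply maps_dom; eauto. }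
  assert (Dm : forall y v, maps b y v -> y ∈ k).
  { intros y v Hy; apply (proj1 Ok) with m; [assumption|]; eapply maps_dom; eauto. }
  set (E := fun h v => exists y, dbl y h /\ maps a y v).
  set (O := fun h v => exists y e, is_succ h e /\ dbl y e /\ maps b y v).
  assert (FE : forall h v w, E h v -> E h w -> v = w).
  { intros h v w (y & Hy & Hv) (z & Hz & Hw).
    assert (z = y) as -> by eauto using dbl_inj; eauto using maps_fun. }
  assert (FO : forall h v w, O h v -> O h w -> v = w).
  { intros h v w (y & e & He & Hy & Hv) (z & g & Hg & Hz & Hw).
    rewrite (succ_inj Z _ _ _ Hg He) in Hz.
    assert (z = y) as -> by eauto using dbl_inj; eauto using maps_fun. }
  assert (FEO : forall h v w, E h v -> O h w -> False).
  { intros h v w (y & Hy & Hv) (z & g & Hg & Hz & Hw).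
    apply (dbl_parity k z y g h); eauto. }
  assert (HD := D_dbl).
  destruct (fun_ex Z (fun h v => E h v \/ O h v \/
    (~ (exists w, E h w) /\ ~ (exists w, O h w) /\ v = d0)) p) as (c & Hc & K).
  { unfold E, O; dfn. }
  { apply (dbl_rec q p Hp). }
  { intros h _; destruct (classic (exists w, E h w)) as [[w Hw]|NE].
    - exists w; split; [auto|]; intros v [Hv|[Hv|[[] _]]]; eauto.
      destruct (FEO _ _ _ Hw Hv).
    - destruct (classic (exists w, O h w)) as [[w Hw]|NO].
      + exists w; split; [auto|]; intros v [Hv|[Hv|[_ [[] _]]]]; eauto.
        destruct NE; eauto.
      + exists d0; split; [auto|]; intros v [Hv|[Hv|[_ [_ ?]]]]; auto.
        * destruct NE; eauto.
        * destruct NO; eauto. }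
  exists c, p; split; [assumption|]; split; [split; [assumption|split]|].
  - eapply mem_set; eauto.
  - intros h v Hv; apply K in Hv as [_ [(y & _ & Hv)|[(y & e & _ & _ & Hv)|[_ [_ ->]]]]]; eauto.
  - intros v [[i Hi]|[i Hi]].
    + destruct (dbl_total i (ordinal_tr _ _ Ok (Dn _ _ Hi))) as [h Hh].
      exists h; apply K; split; [|left; exists i; auto].
      apply (dbl_mono i q h p); auto. apply Hnq; eapply maps_dom; eauto.
    + destruct (dbl_total i (ordinal_tr _ _ Ok (Dm _ _ Hi))) as [h Hh].
      destruct (succ_ex Z h) as [s Hs].
      exists s; apply K; split; [|right; left; exists i, h; auto].
      apply (dbl_mono i q h p); auto. apply Hmq; eapply maps_dom; eauto.
Qed.

(** Turns an atom into a sequence, so that it can be merged with a support. *)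
Lemma singleton_sequence (k A x : M) : infinite_cardinal k -> is_set A -> x ∈ A ->
  exists b m, m ∈ k /\ is_fun b m A /\ exists i, maps b i x.
Proof.
  intros Ck SA Hx; destruct (infinite_cardinal_limit k Ck) as [Ok Lk].
  destruct (infinite_ordinal_nonempty k Ok (proj2 Ck)) as (o & Ho & _).
  destruct (Lk o Ho) as (s & Hs & Ss).
  destruct (fun_ex Z (fun _ v => v = x) s) as (b & Hb & K).
  { dfn. }
  { apply Ss. }
  { intros z _; exists x; split; auto. }
  exists b, s; split; [assumption|]; split; [split; [assumption|split; [assumption|]]|].
  - intros z v Hv; apply K in Hv as [_ ->]; assumption.
  - exists o; apply K; split; [apply Ss; auto|reflexivity].
Qed.

End Ordinals.

(** * Permutations and supports *)

Section Permutations.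
Context {M : structure} (Z : ZFA M).

Lemma comp_ex (s n X pi Y : M) : is_fun s n X -> is_fun pi X Y ->
  exists t, is_fun t n Y /\ is_comp t pi s.
Proof.
  intros [Hs [_ Cs]] [Hp [SY Cp]].
  destruct (fun_ex Z (fun x z => exists y, maps s x y /\ maps pi y z) n) as (t & Ht & K).
  { dfn. }
  { apply Hs. }
  { intros x Hx; destruct (maps_total _ _ _ Hs Hx) as [y Hy].
    destruct (maps_total _ _ _ Hp (Cs _ _ Hy)) as [z Hz].
    exists z; split; [eauto|]; intros z' (y' & Hy' & Hz').
    rewrite (maps_fun _ _ _ _ _ Hs Hy' Hy) in Hz'; exact (maps_fun _ _ _ _ _ Hp Hz Hz'). }
  assert (Ct : is_comp t pi s).
  { intros x z; rewrite K; split; [intros [_ H]; assumption|].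
    intros H; split; [|assumption]; destruct H as (y & Hy & _); exact (maps_dom _ _ _ _ Hs Hy). }
  exists t; split; [|assumption]; split; [assumption|split; [assumption|]].
  intros x z Hxz; apply Ct in Hxz as (y & _ & Hz); eauto.
Qed.

Lemma comp_bij (s X Y pi W : M) : is_bij s X Y -> is_bij pi Y W ->
  exists t, is_bij t X W /\ is_comp t pi s.
Proof.
  intros [Hs Is] [Hp Ip]; destruct (comp_ex s X Y pi W Hs Hp) as (t & Ht & C).
  exists t; split; [split; [assumption|]|assumption].
  intros z Hz; destruct (Ip z Hz) as (y & Hy & Uy).
  destruct (Is y) as (x & Hx & Ux); [exact (maps_dom _ _ _ _ (proj1 Hp) Hy)|].
  exists x; split; [apply C; eauto|].
  intros x' Hx'; apply C in Hx' as (y' & H1 & H2).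
  rewrite <- (Uy _ H2) in H1; auto.
Qed.

Lemma inv_bij (pi X Y : M) : is_bij pi X Y ->
  exists rho, is_bij rho Y X /\ forall a b, maps rho a b <-> maps pi b a.
Proof.
  intros [[Hp [SY Cp]] Ip].
  destruct (fun_ex Z (fun y x => maps pi x y) Y) as (rho & Hr & K).
  { dfn. }
  { assumption. }
  { assumption. }
  assert (K' : forall a b, maps rho a b <-> maps pi b a).
  { intros a b; rewrite K; split; [tauto|]; intros H; split; eauto. }
  exists rho; split; [|assumption].
  split; [split; [assumption|split; [apply Hp|]]|].
  - intros y x H; apply K' in H; exact (maps_dom _ _ _ _ Hp H).
  - intros x Hx; destruct (maps_total _ _ _ Hp Hx) as [y Hy].
    exists y; split; [apply K'; assumption|].
    intros y' Hy'; apply K' in Hy'; exact (maps_fun _ _ _ _ _ Hp Hy Hy').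
Qed.

Lemma in_Sym_bij (A pi : M) : is_atoms A -> in_Sym pi -> is_bij pi A A.
Proof.
  intros HA (B & HB & H); rewrite (atoms_unique Z A B); assumption.
Qed.

Lemma stabilizer_subgroup (G S x : M) : perm_group G -> tr x -> is_stab S G x ->
  subgroup S G.
Proof.
  intros PG Hx [SS KS]; assert (PG' := PG).
  destruct PG' as (SG & Sy & (i & Hi & Ki) & Cm & Iv).
  split; [|split; [assumption|]].
  2:{ intros pi Hpi; apply KS in Hpi; tauto. }
  split; [assumption|]; split; [|split; [|split]].
  - intros pi Hpi; apply KS in Hpi as [Hpi _]; auto.
  - exists i; split; [|assumption]; apply KS; split; [assumption|].
    destruct Hx as (t & Ht & Hx).
    apply (acts_fix Z i t); auto. intros a _ Ha; apply Ki; auto.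
  - intros pi sg Hpi Hsg; apply KS in Hpi as [Hpi Ap], Hsg as [Hsg As].
    destruct (Cm _ _ Hpi Hsg) as (rho & Hrho & C); exists rho; split; [|assumption].
    apply KS; split; [assumption|].
    apply (acts_comp Z pi sg rho x x x); auto.
  - intros pi Hpi; apply KS in Hpi as [Hpi Ap].
    destruct (Iv _ Hpi) as (rho & Hrho & C); exists rho; split; [|assumption].
    apply KS; split; [assumption|].
    apply (acts_inv Z pi rho x x); auto.
Qed.

(** By [acts_seq] this is [acts g a a] for sequences of atoms, stated through the entries so that
    only the range of the sequence matters. *)
Definition fixes (g a : M) : Prop := forall i v, maps a i v -> maps g v v.

Definition supports (G a y : M) : Prop :=
  forall g, g ∈ G -> fixes g a -> acts g y y.

Lemma stab_ex (G x : M) : exists S, is_stab S G x.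
Proof.
  destruct (separation Z (fun pi => acts pi x x) G) as (S & SS & KS); [dfn|].
  exists S; split; assumption.
Qed.

(** The stabilizer of [y] is a subgroup, so it belongs to [F] exactly when it contains the
    stabilizer of some sequence. *)
Lemma symmetric_iff (A k G F y : M) : is_atoms A -> is_ordinal k -> perm_group G ->
  is_support_filter F k G -> tr y ->
  (symmetric G F y <-> exists a n, n ∈ k /\ is_fun a n A /\ supports G a y).
Proof.
  intros HA Ok PG [SF KF] Hy.
  assert (Seq : forall g a n, g ∈ G -> n ∈ k -> is_fun a n A -> (acts g a a <-> fixes g a)).
  { intros g a n Hg Hn Ha; apply (acts_seq Z g a n A); auto.
    - apply PG, Hg.
    - exact (ordinal_mem Z k n Ok Hn). }
  split.
  - intros (S & [_ HS] & HSF); apply KF in HSF as (_ & a & Sa & (B & n & HB & Hn & Ha) & [_ HSa] & Sub).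
    rewrite (atoms_unique Z B A HB HA) in Ha.
    exists a, n; split; [assumption|]; split; [assumption|].
    intros g Hg Hf; apply HS, Sub, HSa; split; [assumption|]; eapply Seq; eauto.
  - intros (a & n & Hn & Ha & Hs).
    destruct (stab_ex G y) as [S HS], (stab_ex G a) as [Sa HSa].
    exists S; split; [assumption|]; apply KF.
    split; [eapply stabilizer_subgroup; eauto|].
    exists a, Sa; split; [exists A, n; auto|]; split; [assumption|].
    intros g Hg; apply HSa in Hg as [Hg Hga]; apply HS; split; [assumption|].
    apply Hs; [assumption|]; eapply Seq; eauto.
Qed.

(** Pairs over [X] lie in its second power set and sets of such pairs in the third; Separation needs
    these bounds. *)
Lemma opair_bound (X : M) : exists B, is_set B /\
  (forall p x y, is_opair p x y -> x ∈ X -> y ∈ X -> p ∈ B) /\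
  exists B', forall f, is_set f ->
    (forall p, p ∈ f -> exists x y, is_opair p x y /\ x ∈ X /\ y ∈ X) -> f ∈ B'.
Proof.
  destruct (zfa_powerset Z X) as (P1 & _ & K1).
  destruct (zfa_powerset Z P1) as (P2 & S2 & K2).
  destruct (zfa_powerset Z P2) as (P3 & _ & K3).
  assert (Hp : forall p x y, is_opair p x y -> x ∈ X -> y ∈ X -> p ∈ P2).
  { intros p x y (s & d & [Ss Hs] & [Sd Hd] & [Sp Hp]) Hx Hy.
    apply K2; split; [assumption|]; intros z Hz; apply K1; apply Hp in Hz as [->| ->].
    - split; [assumption|]; intros w Hw; apply Hs in Hw as [->| ->]; assumption.
    - split; [assumption|]; intros w Hw; apply Hd in Hw as [->| ->]; assumption. }
  exists P2; split; [assumption|]; split; [assumption|].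
  exists P3; intros f Sf Hf; apply K3; split; [assumption|].
  intros p Hpf; destruct (Hf p Hpf) as (x & y & Hq & Hx & Hy); eauto.
Qed.

(** One bound for all domains contained in [X]: with [X] equal to kappa it covers sequences of every
    admissible length. *)
Lemma fun_bound (X Y : M) : exists B, forall s n, is_fun s n Y -> subset n X -> s ∈ B.
Proof.
  destruct (cup_ex Z X Y) as (U & _ & KU).
  destruct (opair_bound U) as (_ & _ & _ & B & HB).
  exists B; intros s n [Hs [_ Cs]] Hn; apply HB; [apply Hs|].
  intros p Hp; assert (Hs' := Hs); destruct Hs' as (_ & _ & H & _).
  destruct (H p Hp) as (x & y & Hx & Hq); exists x, y; split; [assumption|].
  split; apply KU; [left; auto|right; apply (Cs x); exists p; auto].
Qed.

End Permutations.

(** * The closure of a permutation group *)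

Section Closure.
Context {M : structure} (Z : ZFA M) (A k G : M).
Hypotheses (HA : is_atoms A) (Ok : is_ordinal k) (PG : perm_group G).

Definition invariant (n R : M) : Prop :=
  forall g s t, g ∈ G -> is_fun s n A -> is_fun t n A -> is_comp t g s ->
    (s ∈ R <-> t ∈ R).

Definition invariant_predicate (r : M) : Prop :=
  exists n R, is_opair r n R /\ n ∈ k /\ is_set R /\
    (forall s, s ∈ R -> is_fun s n A) /\ invariant n R.

(** A code (n, R) has [n] in [k] and [R] in the power set of a set containing all sequences, so the
    codes form a set. *)
Lemma invariant_predicates_ex : exists I, is_set I /\
  forall r, r ∈ I <-> invariant_predicate r.
Proof.
  destruct (fun_bound Z k A) as [Q HQ].
  destruct (zfa_powerset Z Q) as (Q' & _ & KQ).
  destruct (cup_ex Z k Q') as (U & _ & KU).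
  destruct (opair_bound Z U) as (B & _ & HB & _).
  destruct (separation Z invariant_predicate B) as (I & SI & KI).
  { unfold invariant_predicate, invariant; dfn. }
  exists I; split; [assumption|]; intros r; rewrite KI; split; [tauto|].
  intros H; split; [|assumption].
  destruct H as (n & R & Hr & Hn & SR & HR & _); apply (HB r n R Hr); apply KU; auto.
  right; apply KQ; split; [assumption|]; intros s Hs; apply (HQ s n); auto.
  intros z Hz; eapply (proj1 Ok); eauto.
Qed.

Definition agree (pi g s : M) : Prop :=
  forall i v, maps s i v -> exists w, maps pi v w /\ maps g v w.

Lemma closure_structure : exists S H,
  is_kappa_structure k A S /\ is_Aut H S /\ perm_group H /\ subset G H /\
  forall pi s n, pi ∈ H -> n ∈ k -> is_fun s n A -> exists g, g ∈ G /\ agree pi g s.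
Proof.
  assert (SA : is_set A) by apply HA.
  assert (PG' := PG); destruct PG' as (SG & Sy & (i0 & Hi0 & Ki0) & Cm & Iv).
  assert (Bij : forall g, g ∈ G -> is_bij g A A).
  { intros g Hg; apply (in_Sym_bij Z); auto. }
  destruct invariant_predicates_ex as (I & SI & KI).
  (* The family of predicates is indexed by itself, through the identity on [I]. *)
  destruct (fun_ex Z (fun r r' => r = r') I) as (P & HP & KP); [dfn|assumption| |].
  { intros r _; exists r; split; auto. }
  destruct (opair_ex Z A P) as (S & HS).
  destruct (fun_bound Z A A) as [B HB].
  destruct (separation Z (is_automorphism S) B) as (H & SH & KH).
  { dfn. }
  assert (KH' : forall pi, pi ∈ H <-> is_bij pi A A /\
    forall r n R, r ∈ I -> is_opair r n R ->
      forall s t, is_fun s n A -> is_fun t n A -> is_comp t pi s -> (s ∈ R <-> t ∈ R)).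
  { intros pi; rewrite KH; split.
    - intros (_ & A' & P' & HS' & Hb & L).
      destruct (opair_inj _ _ _ _ _ HS HS') as [<- <-]; split; [assumption|].
      intros r n R Hr; apply (L r); apply KP; auto.
    - intros [Hb L]; split; [apply (HB pi A); [apply Hb|intros z Hz; assumption]|].
      exists A, P; split; [assumption|]; split; [assumption|].
      intros i r n R Hir; apply KP in Hir as [Hi <-]; eauto. }
  assert (BH : forall pi, pi ∈ H -> is_bij pi A A).
  { intros pi Hpi; apply KH' in Hpi; tauto. }
  exists S, H; split; [|split; [|split; [|split]]].
  - split; [assumption|]; exists P, I; split; [assumption|]; split; [assumption|].
    intros i r Hir; apply KP in Hir as [Hi <-].
    apply KI in Hi as (n & R & H1 & H2 & H3 & H4 & _); exists n, R; auto.
  - split; [assumption|]; intros pi; rewrite KH; split; [tauto|]; intros L; split; [|assumption].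
    destruct L as (A' & P' & HS' & Hb & _).
    destruct (opair_inj _ _ _ _ _ HS HS') as [<- <-].
    apply (HB pi A); [apply Hb|intros z Hz; assumption].
  - split; [assumption|]; split; [|split; [|split]].
    + intros pi Hpi; exists A; auto.
    + exists i0; split; [|assumption]; apply KH'; split; [auto|].
      intros r n R Hr Hnr s t Hs Ht C; replace t with s; [tauto|].
      apply (fun_ext Z s t n n); [apply Hs|apply Ht|].
      intros x y; rewrite (C x y); split.
      * intros Hxy; exists y; split; [assumption|]; apply Ki0; split; [|reflexivity].
        apply HA; eapply Hs; eauto.
      * intros (y' & Hy' & L); apply Ki0 in L as [_ <-]; assumption.
    + intros pi sg Hpi Hsg.
      destruct (comp_bij Z sg A A pi A) as (rho & Br & Cr); auto.
      exists rho; split; [|assumption]; apply KH'; split; [assumption|].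
      intros r n R Hr Hnr s t Hs Ht C.
      destruct (comp_ex Z s n A sg A) as (u & Hu & Cu); [assumption|apply BH; assumption|].
      apply KH' in Hpi as [_ Lp], Hsg as [_ Ls].
      rewrite (Ls r n R Hr Hnr s u Hs Hu Cu); apply (Lp r n R Hr Hnr u t Hu Ht).
      intros x z; rewrite (C x z); split.
      * intros (y & Hy & Hz); apply Cr in Hz as (y' & Hy' & Hz).
        exists y'; split; [apply Cu; eauto|assumption].
      * intros (y & Hy & Hz); apply Cu in Hy as (y' & Hy' & Hy).
        exists y'; split; [assumption|]; apply Cr; eauto.
    + intros pi Hpi; destruct (inv_bij Z pi A A) as (rho & Br & Kr); auto.
      exists rho; split; [|assumption]; apply KH'; split; [assumption|].
      intros r n R Hr Hnr s t Hs Ht C; symmetry; apply KH' in Hpi as [Bp Lp].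
      apply (Lp r n R Hr Hnr t s Ht Hs).
      intros x z; split.
      * intros Hz; destruct (maps_total (M := M) rho A z) as [y Hy]; [apply Br|eapply Hs; eauto|].
        exists y; split; [apply C; eauto|apply Kr; assumption].
      * intros (y & Hy & Hz); apply C in Hy as (z' & Hz' & Hy).
        replace z with z'; [assumption|]; apply Kr in Hz.
        destruct Br as [_ Ib]; destruct (Ib y) as (w & _ & Hw).
        { apply Kr in Hy; exact (maps_dom _ _ _ _ (proj1 (proj1 Bp)) Hy). }
        rewrite <- (Hw _ Hy); auto.
  - intros g Hg; apply KH'; split; [auto|]; intros r n R Hr Hnr s t Hs Ht C.
    apply KI in Hr as (n' & R' & Hr & _ & _ & _ & Hinv).
    destruct (opair_inj _ _ _ _ _ Hnr Hr) as [-> ->]; eapply Hinv; eauto.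
  - intros pi s n Hpi Hn Hs.
    destruct (fun_bound Z k A) as [Q HQ].
    assert (Hnk : subset n k) by (intros z Hz; eapply (proj1 Ok); eauto).
    (* [R] is the orbit of [s] under [G]. Since [pi] preserves it, the composite of [pi] and [s] is
       also that of some [g] in [G] and [s]. *)
    destruct (separation Z (fun t => is_fun t n A /\ exists g, g ∈ G /\ is_comp t g s) Q)
      as (R & SR & KR); [dfn|].
    assert (KR' : forall t, t ∈ R <-> is_fun t n A /\ exists g, g ∈ G /\ is_comp t g s).
    { intros t; rewrite KR; split; [tauto|]; intros L; split; [|assumption].
      apply (HQ t n); tauto. }
    assert (Hinv : forall g u t, g ∈ G -> is_fun t n A ->
      is_comp t g u -> u ∈ R -> t ∈ R).
    { intros g u t Hg Ht C Hu; apply KR' in Hu as (Fu & h & Hh & Cu).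
      destruct (Cm _ _ Hg Hh) as (f & Hf & Cf).
      apply KR'; split; [assumption|]; exists f; split; [assumption|].
      intros x z; rewrite (C x z); split.
      * intros (y & Hy & Hz); apply Cu in Hy as (w & Hw & Hy).
        exists w; split; [assumption|]; apply Cf; eauto.
      * intros (y & Hy & Hz); apply Cf in Hz as (w & Hw & Hz).
        exists w; split; [apply Cu; eauto|assumption]. }
    destruct (opair_ex Z n R) as [r Hr].
    assert (HrI : r ∈ I).
    { apply KI; exists n, R; repeat (split; [solve [auto]|]).
      split; [intros t Ht; apply KR' in Ht; tauto|].
      intros g u t Hg Hu Ht C; split; intros L; [apply (Hinv g u t); auto|].
      (* The other direction of invariance is [Hinv] for the inverse of [g]. *)
      destruct (Iv _ Hg) as (h & Hh & Kh); apply (Hinv h t u); auto.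
      assert (Sg := Sy _ Hg).
      intros x z; split.
      * intros Hz; destruct (in_Sym_total g z Sg) as [y Hy]; [apply HA; eapply Hu; eauto|].
        exists y; split; [apply C; eauto|apply Kh; assumption].
      * intros (y & Hy & Hz); apply C in Hy as (z' & Hz' & Hy); apply Kh in Hz.
        rewrite (in_Sym_inj g z z' y); auto. }
    destruct (comp_ex Z s n A pi A Hs) as (t & Ht & Ct); [apply BH; assumption|].
    apply KH' in Hpi as [Bp Lp].
    assert (HsR : s ∈ R).
    { apply KR'; split; [assumption|]; exists i0; split; [assumption|].
      intros x z; split.
      * intros Hz; exists z; split; [assumption|]; apply Ki0; split; [|reflexivity].
        apply HA; eapply Hs; eauto.
      * intros (y & Hy & L); apply Ki0 in L as [_ <-]; assumption. }
    apply (Lp r n R HrI Hr s t Hs Ht Ct) in HsR.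
    apply KR' in HsR as (_ & g & Hg & Cg); exists g; split; [assumption|].
    intros i v Hiv.
    destruct (maps_total (M := M) pi A v) as [w Hw]; [apply Bp|eapply Hs; eauto|].
    exists w; split; [assumption|].
    assert (L : maps t i w) by (apply Ct; eauto).
    apply Cg in L as (v' & Hv' & L).
    rewrite (maps_fun s n i v v'); auto; apply Hs.
Qed.

End Closure.

(** * Transfer of supports between a group and its closure *)

Section Supports.
Context {M : structure} (Z : ZFA M) (A k G H : M).
Hypotheses (HA : is_atoms A) (Ck : infinite_cardinal k)
  (PG : perm_group G) (PH : perm_group H) (GH : subset G H)
  (dense : forall pi s n, pi ∈ H -> n ∈ k -> is_fun s n A ->
    exists g, g ∈ G /\ agree pi g s).

Lemma agree_fixes (pi g a c : M) : in_Sym pi -> in_Sym g -> agree pi g c ->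
  (forall v, (exists i, maps a i v) -> exists j, maps c j v) ->
  fixes pi a -> fixes g a.
Proof.
  intros Sp Sg Hag Hc Hf i v Hv.
  destruct (Hc v) as [j Hj]; [eauto|].
  destruct (Hag j v Hj) as (w & Hw & Hg).
  rewrite (in_Sym_fun _ _ _ _ Sp (Hf i v Hv) Hw) at 2; assumption.
Qed.

(** The sequence [a] stays quantified in the induction, as a member [u] of [x] has its own support
    [b], provided by the hypothesis on [t]. Only one [u] is treated at a time, so no choice of
    supports is made. *)
Lemma supports_closure (t y : M) : transitive t ->
  (forall u, u ∈ t -> exists b m, m ∈ k /\ is_fun b m A /\ supports G b u) ->
  y ∈ t -> forall a n, n ∈ k -> is_fun a n A -> supports G a y -> supports H a y.
Proof.
  intros Tt Ht Hy; assert (Ty : tr y) by (exists t; auto).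
  assert (Lk := infinite_cardinal_limit Z k Ck).
  revert Hy; unfold supports, fixes; tr_induction y Ty.
  intros x Tx IH Hx a n Hn Ha Hs.
  assert (SG : forall g, g ∈ G -> in_Sym g) by apply PG.
  assert (SH : forall g, g ∈ H -> in_Sym g) by apply PH.
  destruct (classic (atom x)) as [Ax|Sx].
  - intros pi Hpi Hf.
    (* An atom has no members to induct on; it is merged with [a] instead, so that [g] agrees with
       [pi] at [x]. *)
    destruct (singleton_sequence Z k A x Ck) as (b & m & Hm & Hb & i & Hi).
    { apply HA. }
    { apply HA, Ax. }
    destruct (merge_sequences Z k A a n b m) as (c & p & Hp & Hc & Kc); auto.
    destruct (dense pi c p Hpi Hp Hc) as (g & Hg & Hag).
    assert (Hgx : maps g x x).
    { apply (acts_atom Z); auto; apply Hs; auto.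
      apply (agree_fixes pi g a c); auto. }
    destruct (Kc x) as [j Hj]; [eauto|].
    destruct (Hag j x Hj) as (w & Hw & Hw').
    rewrite (in_Sym_fun g x w x) in Hw; auto; apply (acts_atom Z); auto.
  (* This is one inclusion, the image of [x] lying in [x]; the other is [Key] for the inverse of
     [pi]. *)
  - assert (Key : forall pi, pi ∈ H -> fixes pi a ->
      forall u v, u ∈ x -> acts pi u v -> v ∈ x).
    { intros pi Hpi Hf u v Hu Huv.
      assert (Hut : u ∈ t) by (apply (proj2 Tt) with x; assumption).
      destruct (Ht u Hut) as (b & m & Hm & Hb & Hsb).
      destruct (merge_sequences Z k A a n b m) as (c & p & Hp & Hc & Kc); auto.
      destruct (dense pi c p Hpi Hp Hc) as (g & Hg & Hag).
      destruct PH as (_ & _ & _ & CmH & IvH).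
      destruct (IvH g (GH _ Hg)) as (g' & Hg' & Kg').
      (* [sg], the inverse of [g] after [pi], lies in [H] and fixes [b], so the induction hypothesis
         applies to it. *)
      destruct (CmH g' pi Hg' Hpi) as (sg & Hsg & Csg).
      assert (Fsg : fixes sg b).
      { intros i w Hw; apply Csg.
        destruct (Kc w) as [j Hj]; [eauto|].
        destruct (Hag j w Hj) as (w' & H1 & H2); exists w'; split; [assumption|].
        apply Kg'; assumption. }
      assert (Hu1 : acts sg u u) by (apply (IH u Hu Hut b m Hm Hb Hsb); auto).
      destruct (acts_total Z g u (SG _ Hg) (tr_mem _ _ Tx Hu)) as [w Hw].
      assert (C : is_comp pi g sg).
      { intros r s; split.
        - intros Hrs; destruct (in_Sym_maps _ _ _ (SH _ Hpi) Hrs) as [_ As].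
          destruct (in_Sym_surj g s (SG _ Hg) As) as [q Hq].
          exists q; split; [apply Csg; exists s; split; [|apply Kg']; assumption|assumption].
        - intros (q & Hq & Hqs); apply Csg in Hq as (s' & Hs' & Hq); apply Kg' in Hq.
          rewrite (in_Sym_fun g q s s'); auto. }
      assert (Hpw : acts pi u w) by (apply (acts_comp Z g sg pi u u w); auto).
      rewrite (acts_fun Z pi u v w); auto.
      apply (acts_mem Z g x x u w); auto.
      apply Hs; auto. apply (agree_fixes pi g a c); auto. }
    intros pi Hpi Hf; apply (acts_set Z); auto; split; [assumption|].
    intros v; split; [|intros (u & Hu & Huv); eapply Key; eauto].
    intros Hv; destruct (proj2 (proj2 (proj2 (proj2 PH))) pi Hpi) as (rho & Hrho & Kr).
    destruct (acts_total Z rho v (SH _ Hrho) (tr_mem _ _ Tx Hv)) as [u Hu].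
    exists u; split.
    + apply (Key rho Hrho) with v; auto. intros i w Hw; apply Kr, (Hf i w Hw).
    + apply (acts_inv Z rho pi); auto. intros a' b'; rewrite Kr; reflexivity.
Qed.

Lemma symmetric_closure_iff (F FH t : M) :
  is_support_filter F k G -> is_support_filter FH k H -> transitive t ->
  ((forall y, y ∈ t -> symmetric G F y) <-> (forall y, y ∈ t -> symmetric H FH y)).
Proof.
  intros HF HFH Tt.
  assert (Ok : is_ordinal k) by apply Ck.
  assert (EG : forall y, y ∈ t -> (symmetric G F y <->
    exists a n, n ∈ k /\ is_fun a n A /\ supports G a y)).
  { intros y Hy; apply (symmetric_iff Z); auto; exists t; auto. }
  assert (EH : forall y, y ∈ t -> (symmetric H FH y <->
    exists a n, n ∈ k /\ is_fun a n A /\ supports H a y)).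
  { intros y Hy; apply (symmetric_iff Z); auto; exists t; auto. }
  split; intros L y Hy.
  - apply EH; [assumption|].
    destruct (proj1 (EG y Hy) (L y Hy)) as (a & n & Hn & Ha & Hs).
    exists a, n; split; [assumption|]; split; [assumption|].
    apply (supports_closure t y Tt) with n; auto.
    intros u Hu; apply EG; auto.
  - apply EG; [assumption|].
    destruct (proj1 (EH y Hy) (L y Hy)) as (a & n & Hn & Ha & Hs).
    exists a, n; split; [assumption|]; split; [assumption|].
    intros g Hg; apply Hs, GH, Hg.
Qed.

Lemma support_filter_ex : exists F, is_support_filter F k H.
Proof.
  destruct (zfa_powerset Z H) as (P & _ & KP).
  destruct (separation Z (fun K => subgroup K H /\
    exists a S, atom_seq_lt k a /\ is_stab S H a /\ subset S K) P) as (F & SF & KF).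
  { dfn. }
  exists F; split; [assumption|]; intros K; rewrite KF; split; [tauto|].
  intros L; split; [|assumption]; apply KP.
  destruct L as [([SK _] & _ & L) _]; auto.
Qed.

End Supports.

Theorem mainTheorem1 (M : structure) (M_ZFA : ZFA M) (A kappa : M) (N : M -> Prop)
    (A_atoms : is_atoms A) (kappa_card : infinite_cardinal kappa)
    (N_support : support_permutation_model kappa N) :
  exists S H F : M,
    is_kappa_structure kappa A S /\
    is_Aut H S /\
    is_support_filter F kappa H /\
    forall x : M, N x <-> PM H F x.
Proof.
  destruct N_support as (G & F & PG & HF & HN).
  assert (Ok : is_ordinal kappa) by apply kappa_card.
  destruct (closure_structure M_ZFA A kappa G A_atoms Ok PG)
    as (S & H & HS & HH & PH & GH & dense).
  destruct (support_filter_ex M_ZFA kappa H) as [FH HFH].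
  exists S, H, FH; repeat (split; [assumption|]).
  intros x; rewrite HN.
  assert (E := symmetric_closure_iff M_ZFA A kappa G H A_atoms kappa_card PG PH GH dense
    F FH).
  (* [t] is the transitive closure of {x}, a transitive set on which [E] compares the two symmetry
     conditions. *)
  split; intros L s t Hs Ht; apply (E t HF HFH (proj1 Ht)); exact (L s t Hs Ht).
Qed.
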